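(* Let $(M,F)$ be a Finsler manifold admitting a concurrent $\pi$-vector field $\overline{\varphi}$ with associated $\pi$-form $\phi=i_{\overline{\varphi}}g$, and let $\Phi=\phi(\overline{\eta})=g(\overline{\varphi},\overline{\eta})$. Let $\widehat F=\frac{F^2}{F-\Phi}$ on $\mathcal D=\{(x,y)\in TM : F(x,y)>\Phi(x,y)\}$, assumed to be a conic pseudo-Finsler structure on $M$, and let hats denote the objects associated with $\widehat F$. Then on $\mathcal D$, for all $\pi$-vector fields $\overline W,\overline Z$: (1) The energy functions $\widehat E=\frac12\widehat F^2$ and $E=\frac12F^2$ satisfy $$d\widehat E=\frac{F^2(F-2\Phi)}{(F-\Phi)^3}\,dE+\frac{F^4}{(F-\Phi)^3}\,d\Phi .$$ (2) The supporting forms satisfy $$\widehat\ell=\frac{F(F-2\Phi)}{(F-\Phi)^2}\,\ell+\frac{F^2}{(F-\Phi)^2}\,\phi .$$ (3) The vertical parts of the Berwald connections agree: $\widehat D^{\circ}_{\gamma\overline W}\overline Z=D^{\circ}_{\gamma\overline W}\overline Z$. (4) The angular metric tensors satisfy $$\widehat\hbar(\overline W,\overline Z)=\frac{F^2(F-2\Phi)}{(F-\Phi)^3}\hbar(\overline W,\overline Z)+\frac{2F^4}{(F-\Phi)^4}\phi(\overline W)\phi(\overline Z)+\frac{2\Phi^2F^2}{(F-\Phi)^4}\ell(\overline W)\ell(\overline Z)-\frac{2\Phi F^3}{(F-\Phi)^4}\left\{\phi(\overline W)\ell(\overline Z)+\phi(\overline Z)\ell(\overline W)\right\}.$$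
   Context: Setting. $M$ is an $n$-dimensional paracompact smooth manifold, $\pi:TM\to M$ its tangent bundle, $\mathcal TM=TM\setminus\{0\}$ the slit tangent bundle. $\pi$-vector fields are smooth sections of the pullback of the bundle $TM\to M$ over $\mathcal TM$ (local basis $\overline{\partial}_i$); their module is $\mathfrak X(\pi)$; $\pi$-forms/tensors are the corresponding (dual) tensor sections. $\gamma$ is the natural injection (vertical lift) $\gamma(W^i\overline\partial_i)=W^i\partial_{y^i}$, $\rho(a^i\partial_{x^i}+b^i\partial_{y^i})=a^i\overline\partial_i$, $J=\gamma\circ\rho$ is the vertical endomorphism, $\overline\eta(u)=(u,u)$ (i.e. $\overline\eta=y^i\overline\partial_i$), $\mathcal C=\gamma\overline\eta$ is the Liouville field, and $d_Jf=df\circ J$ for functions $f$. Finsler structure: $F:TM\to[0,\infty)$, $C^\infty$ on $\mathcal TM$, $C^0$ on $TM$, positively homogeneous of degree 1 in $y$, with $dd_JE$ of maximal rank, $E=\frac12F^2$. Metric tensor: $g(\rho W,\rho Z)=dd_JE(JW,Z)$ (it is positive definite). Supporting form $\ell=F^{-1}i_{\overline\eta}g$; angular metric tensor $\hbar=g-\ell\otimes\ell$. Geodesic spray $G$: $JG=\mathcal C$, $[\mathcal C,G]=G$, $i_Gdd_JE=-dE$. Barthel connection $\Gamma=[J,G]$ (i.e. $\Gamma X=[JX,G]-J[X,G]$), horizontal/vertical projectors $h=\frac12(I+\Gamma)$, $v=\frac12(I-\Gamma)$, horizontal map $\beta=(\rho|_{\mathrm{Im}\,h})^{-1}$. Berwald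 connection $D^\circ$ on the pullback bundle: $\gamma D^\circ_{hZ}\rho W=v[hZ,JW]$, $D^\circ_{\gamma\overline Z}\overline W=\rho[\gamma\overline Z,\beta\overline W]$. Cartan connection $\nabla$: determined by $2g(\nabla_{\gamma\overline X}\overline Y,\overline Z)=\gamma\overline X\cdot g(\overline Y,\overline Z)+g(\overline Y,\rho[\beta\overline Z,\gamma\overline X])+g(\overline Z,\rho[\gamma\overline X,\beta\overline Y])$ and $2g(\nabla_{\beta\overline X}\overline Y,\overline Z)=\beta\overline X\cdot g(\overline Y,\overline Z)+\beta\overline Y\cdot g(\overline Z,\overline X)-\beta\overline Z\cdot g(\overline X,\overline Y)-g(\overline X,\rho[\beta\overline Y,\beta\overline Z])+g(\overline Y,\rho[\beta\overline Z,\beta\overline X])+g(\overline Z,\rho[\beta\overline X,\beta\overline Y])$. Concurrent $\pi$-vector field: a non-vanishing $\pi$-vector field $\overline\varphi$ with $\nabla_{\beta\overline W}\overline\varphi=-\overline W=D^\circ_{\beta\overline W}\overline\varphi$ and $\nabla_{\gamma\overline W}\overline\varphi=0=D^\circ_{\gamma\overline W}\overline\varphi$ for all $\overline W$. Conic pseudo-Finsler structure on $M$: a smooth function to $[0,\infty)$ on a conic sub-bundle $\mathcal D\subset\mathcal TM$ (non-empty, open, invariant under scaling by positive reals, $\pi(\mathcal D)=M$, each fibre $\mathcal D_x$ connected), positively 1-homogeneous in $y$, whose form $dd_J(\frac12(\cdot)^2)$ has maximal rank. For the conic pseudo-Finsler structure $\widehat F$, the energy $\widehat E=\frac12\widehat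 F^2$, metric tensor $\widehat g$, supporting form $\widehat\ell$, angular metric tensor $\widehat\hbar$, geodesic spray $\widehat G$, Barthel connection $\widehat\Gamma$, projectors $\widehat h,\widehat v$, horizontal map $\widehat\beta$, Berwald connection $\widehat D^\circ$ and Cartan connection $\widehat\nabla$ are defined on $\mathcal D$ by the same formulas as the corresponding unhatted objects of $F$. *)

(* Defs.v *)
From HB Require Import structures.
From mathcomp Require Import all_boot all_order all_algebra.
From mathcomp Require Import all_classical all_reals all_analysis.

Set Implicit Arguments.
Unset Strict Implicit.
Unset Printing Implicit Defensive.

Import Order.TTheory GRing.Theory Num.Theory.
Import numFieldNormedType.Exports.
Local Open Scope classical_set_scope.
Local Open Scope ring_scope.

(** * Smooth manifolds *)

(* All iterated directional derivatives of [f] exist and are (Frechet)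
   differentiable on [O]; for open [O] this is the C^oo condition. *)
Definition smooth_on (R : realType) (m : nat) (O : set 'rV[R]_m)
    (f : 'rV[R]_m -> R) : Prop :=
  forall (vs : seq 'rV[R]_m) (z : 'rV[R]_m), O z ->
    differentiable (foldr (fun v (g : 'rV[R]_m -> R) => 'D_v g) f vs) z.

Definition smooth_near (R : realType) (m : nat) (z : 'rV[R]_m)
    (f : 'rV[R]_m -> R) : Prop :=
  exists O : set 'rV[R]_m, [/\ open O, O z & smooth_on O f].

Record chart (R : realType) (m : nat) (T : Type) := Chart {
  chart_dom : set T ;
  chart_map :> T -> 'rV[R]_m }.

(* No axioms: see [smooth_manifold]. *)
Record charted (R : realType) (m : nat) := Charted {
  charted_space :> topologicalType ;
  atlas : set (chart R m charted_space) }.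
Arguments atlas {R m}.

(* Every open cover has a locally finite open refinement. *)
Definition paracompact (T : topologicalType) : Prop :=
  forall U : set (set T),
    (forall A, U A -> open A) -> \bigcup_(A in U) A = setT ->
    exists V : set (set T),
      [/\ forall B, V B -> open B,
          \bigcup_(B in V) B = setT,
          forall B, V B -> exists2 A, U A & B `<=` A
        & forall x : T, exists2 N, nbhs x N &
            finite_set [set B | V B /\ B `&` N !=set0]].

Section Charted.
Context {R : realType} {m : nat} (C : charted R m).

Definition smooth_in (c : chart R m C) (f : C -> R) (p : C) : Prop :=
  exists2 g : 'rV[R]_m -> R, smooth_near (c p) g &
    \forall q \near p, f q = g (c q).

(* [f] is C^oo in a neighbourhood of [p]. *)
Definition smooth_at (f : C -> R) (p : C) : Prop :=
  forall c : chart R m C, atlas C c -> chart_dom c p -> smooth_in c f p.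

Record smooth_manifold : Prop := SmoothManifold {
  manifold_hausdorff : hausdorff_space C ;
  manifold_paracompact : paracompact C ;
  (* every chart is a homeomorphism from an open set onto an open set *)
  chart_dom_open : forall c, atlas C c -> open (chart_dom c) ;
  chart_inj : forall c, atlas C c ->
    forall p q, chart_dom c p -> chart_dom c q -> c p = c q -> p = q ;
  chart_continuous : forall c, atlas C c ->
    forall p, chart_dom c p -> {for p, continuous c} ;
  chart_open : forall c, atlas C c ->
    forall A, open A -> A `<=` chart_dom c -> open (c @` A) ;
  atlas_cover : forall p : C, exists2 c, atlas C c & chart_dom c p ;
  (* the components of [d \o c^-1] are smooth *)
  atlas_transition : forall c d, atlas C c -> atlas C d ->
    forall p, chart_dom c p -> chart_dom d p ->
    forall i, smooth_in c (fun q => d q 0 i) p }.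

(** ** Tangent vectors *)

(* A tangent vector at [p] is a directional derivative operator on the
   functions that are smooth at [p].  Operators are totalised by the value 0
   on the other functions, so that equality of tangent vectors is plain
   equality. *)
Definition is_tangent (p : C) (v : (C -> R) -> R) : Prop :=
  (forall f, ~ smooth_at f p -> v f = 0) /\
  (forall c : chart R m C, atlas C c -> chart_dom c p ->
    exists a : 'rV[R]_m, forall f, smooth_at f p ->
      forall g, smooth_near (c p) g -> (\forall q \near p, f q = g (c q)) ->
      v f = 'D_a g (c p)).

Definition tangent_pred (p : C) : {pred ((C -> R) -> R^o)} :=
  fun v => `[< is_tangent p v >].

Record tangent (p : C) := Tangent {
  tangent_fun :> (C -> R) -> R^o ;
  tangentP : tangent_fun \in tangent_pred p }.

Lemma smooth_near_differentiable (z : 'rV[R]_m) (g : 'rV[R]_m -> R) :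
  smooth_near z g -> differentiable g z.
Proof. by case=> O [_ Oz /(_ [::] z Oz)]. Qed.

Lemma tangent_closed (p : C) : submod_closed (tangent_pred p).
Proof.
split=> [|k v w /asboolP [v0 vc] /asboolP [w0 wc]].
  apply/asboolP; split=> // c Cc cp; exists 0 => f _ g gs _.
  by rewrite deriveE ?linear0 //; exact: smooth_near_differentiable.
apply/asboolP; split=> [f nf|c Cc cp].
  by rewrite !fctE v0 // w0 // scaler0 addr0.
have [a va] := vc c Cc cp; have [b wb] := wc c Cc cp.
exists (k *: a + b) => f fs g gs fg.
rewrite !fctE (va _ fs _ gs fg) (wb _ fs _ gs fg).
have dg := smooth_near_differentiable gs.
by rewrite !deriveE // linearP.
Qed.

End Charted.

Arguments tangent {R m C} p.

HB.instance Definition _ (R : realType) (m : nat) (C : charted R m) (p : C) :=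
  [isSub for @tangent_fun R m C p].
HB.instance Definition _ (R : realType) (m : nat) (C : charted R m) (p : C) :=
  [Choice of tangent p by <:].
HB.instance Definition _ (R : realType) (m : nat) (C : charted R m) (p : C) :=
  GRing.SubChoice_isSubLmodule.Build R ((C -> R) -> R^o) (tangent_pred p)
    (tangent p) (tangent_closed p).

(* The tangent vector given by a functional that is only meaningful on the
   functions smooth at [p]; the zero vector if the functional does not define a
   tangent vector. *)
Definition tangent_of (R : realType) (m : nat) (C : charted R m) (p : C)
    (v : (C -> R) -> R) : tangent p :=
  insubd 0 (fun f => if `[< smooth_at f p >] then v f else 0 : R^o).

(* The field [X] is smooth in a neighbourhood of [u]. *)
Definition smooth_field_at (R : realType) (m : nat) (C : charted R m)
    (X : forall q : C, tangent q) (u : C) : Prop :=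
  \forall q \near u, forall f, smooth_at f q -> smooth_at (fun w => X w f) q.

(* [[X, Y] f = X (Y f) - Y (X f)]; this functional defines a tangent vector when
   [X] and [Y] are smooth near [u]. *)
Definition lie_bracket (R : realType) (m : nat) (C : charted R m)
    (X Y : forall q : C, tangent q) : forall q : C, tangent q :=
  fun u => tangent_of u (fun f => X u (fun q => Y q f) - Y u (fun q => X q f)).

(* [dw(X, Y) = X (w Y) - Y (w X) - w [X, Y]]. *)
Definition dform (R : realType) (m : nat) (C : charted R m)
    (w : forall q : C, tangent q -> R) (X Y : forall q : C, tangent q) (u : C)
    : R :=
  X u (fun q => w q (Y q)) - Y u (fun q => w q (X q))
    - w u (lie_bracket X Y u).

(** * The tangent bundle *)

Definition tbundle (R : realType) (n : nat) (M : charted R n) : Type :=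
  {p : M & tangent p}.

Section TangentBundle.
Context {R : realType} {n : nat} (M : charted R n).

HB.instance Definition _ := gen_eqMixin (tbundle M).
HB.instance Definition _ := gen_choiceMixin (tbundle M).

(* The chart [(x^i, y^i)] of the tangent bundle induced by a chart [(x^i)]. *)
Definition tchart (c : chart R n M) : chart R (n + n) (tbundle M) :=
  Chart [set u | chart_dom c (tag u)]
    (fun u => row_mx (c (tag u)) (\row_i (tagged u : tangent (tag u)) (fun q => c q 0 i))).

(* The topology for which the induced charts are homeomorphisms onto open
   sets. *)
Definition tbundle_open (A : set (tbundle M)) : Prop :=
  forall u, A u -> forall c, atlas M c -> chart_dom c (tag u) ->
    \forall z \near tchart c u,
      forall w, chart_dom c (tag w) -> tchart c w = z -> A w.

Lemma tbundle_openT : tbundle_open setT.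
Proof. by move=> u _ c _ _; near=> z. Unshelve. all: by end_near. Qed.

Lemma tbundle_openI : setI_closed tbundle_open.
Proof.
move=> A B oA oB u [Au Bu] c Cc cu.
have hA := oA u Au c Cc cu; have hB := oB u Bu c Cc cu.
by apply: filterS2 hA hB => z hA hB w cw wz; split; [exact: hA|exact: hB].
Qed.

Lemma tbundle_open_bigU (I : Type) (f : I -> set (tbundle M)) :
  (forall i, tbundle_open (f i)) -> tbundle_open (\bigcup_i f i).
Proof.
move=> of_ u [i _ fiu] c Cc cu.
apply: filterS (of_ i u fiu c Cc cu) => z h w cw wz.
by exists i => //; exact: h.
Qed.

HB.instance Definition _ := isOpenTopological.Build (tbundle M)
  tbundle_openT tbundle_openI tbundle_open_bigU.

Definition TM : charted R (n + n) := Charted (tchart @` atlas M).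

(* [pi] *)
Definition tproj (u : TM) : M := tag u.

Definition eta (u : TM) : tangent (tproj u) := tagged u.

Definition slit : set TM := [set u | eta u != 0].

Definition mkTM (x : M) (v : tangent x) : TM := Tagged _ v.

Definition scaleTM (a : R) (u : TM) : TM := mkTM (a *: eta u).

(** * Vector fields on [TM] and [pi]-vector fields

   Fields are total functions; their values matter only on the open set where
   they are considered. *)

Definition field := forall u : TM, tangent u.
Definition pifield := forall u : TM, tangent (tproj u).

Definition smooth_pifield_at (W : pifield) (u : TM) : Prop :=
  \forall q \near u, forall f : M -> R,
    smooth_at f (tproj q) -> smooth_at (fun w : TM => W w f) q.

Definition rho (u : TM) (X : tangent u) : tangent (tproj u) :=
  tangent_of (tproj u) (fun f => X (f \o tproj)).

(* Vertical lift: the velocity at [t = 0] of [t |-> u + t w]. *)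
Definition gam (u : TM) (w : tangent (tproj u)) : tangent u :=
  tangent_of u (fun f => derive1 (fun t : R => f (mkTM (eta u + t *: w))) 0).

Definition vend (u : TM) (X : tangent u) : tangent u := gam (rho X).

Definition rhoF (X : field) : pifield := fun u => rho (X u).
Definition gamF (W : pifield) : field := fun u => gam (W u).
Definition vendF (X : field) : field := fun u => vend (X u).

Definition liouville : field := gamF eta.

Definition extd (f : TM -> R) (u : TM) (X : tangent u) : R := X f.

Definition dJ (f : TM -> R) (u : TM) (X : tangent u) : R := extd f (vend X).

Definition ddJ (f : TM -> R) (X Y : field) (u : TM) : R := dform (@dJ f) X Y u.

(* The 2-form [dd_J f] is non-degenerate at every point of [U]. *)
Definition ddJ_max_rank (U : set TM) (f : TM -> R) : Prop :=
  forall u, U u -> forall X, smooth_field_at X u ->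
    (forall Y, smooth_field_at Y u -> ddJ f X Y u = 0) -> X u = 0.

(** * Finsler structures *)

Definition energy (F : TM -> R) (u : TM) : R := 2^-1 * F u ^+ 2.

Record finsler (F : TM -> R) : Prop := {
  finsler_ge0 : forall u, 0 <= F u ;
  finsler_smooth : forall u, slit u -> smooth_at F u ;
  finsler_continuous : continuous F ;
  finsler_homogeneous : forall a u, 0 < a -> F (scaleTM a u) = a * F u ;
  finsler_rank : ddJ_max_rank slit (energy F) }.

Record conic (D : set TM) : Prop := {
  conic_nonempty : D !=set0 ;
  conic_open : open D ;
  conic_slit : D `<=` slit ;
  conic_scale : forall a u, 0 < a -> D u -> D (scaleTM a u) ;
  conic_onto : tproj @` D = setT ;
  conic_connected : forall x : M, connected (D `&` [set u | tproj u = x]) }.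

Record conic_pseudo_finsler (D : set TM) (F : TM -> R) : Prop := {
  cpf_conic : conic D ;
  cpf_ge0 : forall u, D u -> 0 <= F u ;
  cpf_smooth : forall u, D u -> smooth_at F u ;
  cpf_homogeneous : forall a u, 0 < a -> D u -> F (scaleTM a u) = a * F u ;
  cpf_rank : ddJ_max_rank D (energy F) }.

Definition pitensor2 := forall u : TM, tangent (tproj u) -> tangent (tproj u) -> R.

Record is_metric (U : set TM) (F : TM -> R) (g : pitensor2) : Prop := {
  metric_linearl : forall u, U u -> forall z, scalar (fun w => g u w z) ;
  metric_linearr : forall u, U u -> forall w, scalar (g u w) ;
  metricE : forall u, U u -> forall W Z : field,
    smooth_field_at W u -> smooth_field_at Z u ->
    g u (rho (W u)) (rho (Z u)) = ddJ (energy F) (vendF W) Z u }.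

(* [l = F^-1 i_eta g] *)
Definition supporting (F : TM -> R) (g : pitensor2) (u : TM)
    (w : tangent (tproj u)) : R := (F u)^-1 * g u (eta u) w.

Definition angular (F : TM -> R) (g : pitensor2) (u : TM)
    (w z : tangent (tproj u)) : R :=
  g u w z - supporting F g w * supporting F g z.

Record is_geodesic_spray (U : set TM) (F : TM -> R) (G : field) : Prop := {
  spray_smooth : forall u, U u -> smooth_field_at G u ;
  spray_J : forall u, U u -> vend (G u) = liouville u ;
  spray_homogeneous : forall u, U u -> lie_bracket liouville G u = G u ;
  spray_geodesic : forall u, U u -> forall X, smooth_field_at X u ->
    ddJ (energy F) G X u = - extd (energy F) (X u) }.

(* Barthel connection [[J, G]] and its projectors. *)
Definition barthel (G X : field) : field :=
  fun u => lie_bracket (vendF X) G u - vend (lie_bracket X G u).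

Definition hproj (G X : field) : field := fun u => 2^-1 *: (X u + barthel G X u).
Definition vproj (G X : field) : field := fun u => 2^-1 *: (X u - barthel G X u).

Definition hmap := forall u : TM, tangent (tproj u) -> tangent u.

Definition hmapF (beta : hmap) (W : pifield) : field := fun u => beta u (W u).

(* [beta] is the inverse of the restriction of [rho] to [Im h]. *)
Record is_horizontal_map (U : set TM) (G : field) (beta : hmap) : Prop := {
  hmap_linear : forall u, U u -> linear (beta u) ;
  hmap_smooth : forall u, U u -> forall W, smooth_pifield_at W u ->
    smooth_field_at (hmapF beta W) u ;
  hmap_rho : forall u, U u -> forall w, rho (beta u w) = w ;
  hmap_horizontal : forall u, U u -> forall w,
    exists2 X, smooth_field_at X u & hproj G X u = beta u w }.

Definition connection := field -> pifield -> pifield.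

(* Linear connections on the pullback bundle over [U]. *)
Record is_connection (U : set TM) (D : connection) : Prop := {
  conn_smooth : forall u, U u -> forall X W,
    smooth_field_at X u -> smooth_pifield_at W u -> smooth_pifield_at (D X W) u ;
  conn_addl : forall u, U u -> forall X Y W,
    smooth_field_at X u -> smooth_field_at Y u -> smooth_pifield_at W u ->
    D (fun q => X q + Y q) W u = D X W u + D Y W u ;
  conn_scalel : forall u, U u -> forall (f : TM -> R) X W,
    smooth_at f u -> smooth_field_at X u -> smooth_pifield_at W u ->
    D (fun q => f q *: X q) W u = f u *: D X W u ;
  conn_addr : forall u, U u -> forall X W Z,
    smooth_field_at X u -> smooth_pifield_at W u -> smooth_pifield_at Z u ->
    D X (fun q => W q + Z q) u = D X W u + D X Z u ;
  conn_leibniz : forall u, U u -> forall (f : TM -> R) X W,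
    smooth_at f u -> smooth_field_at X u -> smooth_pifield_at W u ->
    D X (fun q => f q *: W q) u = extd f (X u) *: W u + f u *: D X W u }.

Record is_berwald (U : set TM) (G : field) (beta : hmap) (D : connection)
    : Prop := {
  berwald_connection : is_connection U D ;
  berwald_h : forall u, U u -> forall Z W : field,
    smooth_field_at Z u -> smooth_field_at W u ->
    gam (D (hproj G Z) (rhoF W) u)
      = vproj G (lie_bracket (hproj G Z) (vendF W)) u ;
  berwald_v : forall u, U u -> forall Z W : pifield,
    smooth_pifield_at Z u -> smooth_pifield_at W u ->
    D (gamF Z) W u = rho (lie_bracket (gamF Z) (hmapF beta W) u) }.

Definition gfun (g : pitensor2) (W Z : pifield) (u : TM) : R := g u (W u) (Z u).

Record is_cartan (U : set TM) (g : pitensor2) (beta : hmap) (nabla : connection)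
    : Prop := {
  cartan_connection : is_connection U nabla ;
  cartan_v : forall u, U u -> forall X Y Z : pifield,
    smooth_pifield_at X u -> smooth_pifield_at Y u -> smooth_pifield_at Z u ->
    2 * g u (nabla (gamF X) Y u) (Z u)
    = extd (gfun g Y Z) (gamF X u)
      + g u (Y u) (rho (lie_bracket (hmapF beta Z) (gamF X) u))
      + g u (Z u) (rho (lie_bracket (gamF X) (hmapF beta Y) u)) ;
  cartan_h : forall u, U u -> forall X Y Z : pifield,
    smooth_pifield_at X u -> smooth_pifield_at Y u -> smooth_pifield_at Z u ->
    2 * g u (nabla (hmapF beta X) Y u) (Z u)
    = extd (gfun g Y Z) (hmapF beta X u)
      + extd (gfun g Z X) (hmapF beta Y u)
      - extd (gfun g X Y) (hmapF beta Z u)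
      - g u (X u) (rho (lie_bracket (hmapF beta Y) (hmapF beta Z) u))
      + g u (Y u) (rho (lie_bracket (hmapF beta Z) (hmapF beta X) u))
      + g u (Z u) (rho (lie_bracket (hmapF beta X) (hmapF beta Y) u)) }.

(* The geometric objects associated with [F] on [U]; each of them is
   determined on [U] by its property. *)
Record finsler_objects (U : set TM) (F : TM -> R) := {
  metric : pitensor2 ;
  spray : field ;
  hlift : hmap ;
  berwald : connection ;
  cartan : connection ;
  metricP : is_metric U F metric ;
  sprayP : is_geodesic_spray U F spray ;
  hliftP : is_horizontal_map U spray hlift ;
  berwaldP : is_berwald U spray hlift berwald ;
  cartanP : is_cartan U metric hlift cartan }.

Record concurrent (F : TM -> R) (O : finsler_objects slit F) (phi : pifield)
    : Prop := {
  concurrent_smooth : forall u, slit u -> smooth_pifield_at phi u ;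
  concurrent_neq0 : forall u, slit u -> phi u != 0 ;
  concurrent_h : forall u, slit u -> forall W, smooth_pifield_at W u ->
    cartan O (hmapF (hlift O) W) phi u = - W u
    /\ berwald O (hmapF (hlift O) W) phi u = - W u ;
  concurrent_v : forall u, slit u -> forall W, smooth_pifield_at W u ->
    cartan O (gamF W) phi u = 0 /\ berwald O (gamF W) phi u = 0 }.

End TangentBundle.

Arguments TM {R n} M.
Arguments slit {R n} M.

(* Main.v *)
(* On the slit bundle the metric is the Hessian of the energy along the fibres,
   g(w, z) = D_w D_z E with D_w the vertical derivative in a constant direction
   w of a chart, because ddJ E (JW, Z) has no other term when Z is constant along
   the fibres.  Homogeneity then gives g(eta, w) = D_w E, so l(w) = D_w F and
   hbar(w, z) = F D_w D_z F.

   The Berwald condition says that phibar is constant along the fibres; hence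
   Phi = g(phibar, eta) = D_phibar E and D_w Phi = g(w, phibar) = phi(w).  The
   Cartan condition adds D_w (phi(z)) = 0 for constant z, so D_w D_z Phi = 0.
   Differentiating Fh F = F^2 + Fh Phi once gives (1) and (2), and twice gives (4).
   For (3), rho [gamma W, beta Z] is the derivative of Z along gamma W, whatever
   the horizontal map beta is.

   Since the bundle TM and its fields are only given through charts, this rests on
   TM being a smooth manifold and on the Lie bracket of smooth fields being a
   tangent vector, i.e. on the symmetry of second derivatives. *)

Require Import Defs.
From mathcomp Require Import all_boot all_order all_algebra.
From mathcomp Require Import all_classical all_reals all_analysis.
From mathcomp Require Import ring lra.
Import Order.TTheory GRing.Theory Num.Theory.
Import numFieldNormedType.Exports.
Local Open Scope classical_set_scope.
Local Open Scope ring_scope.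

Set Implicit Arguments.
Unset Strict Implicit.
Unset Printing Implicit Defensive.

(** * Smooth functions on R^m *)

(** The first-order expansion at [x] involves only values near [x], so it holds for [g] with the
    linear part of [f], which [diff_unique] then identifies as the differential of [g]. *)
Lemma near_eq_differentiable (R : realType) (V W : normedModType R)
    (f g : V -> W) (x : V) :
  (\forall z \near x, f z = g z) -> differentiable f x -> differentiable g x.
Proof.
move=> fg df; have [dfc fE] := (diff_locallyP _ _).1 df.
have gE : g \o shift x = cst (g x) + 'd f x +o_ (0 : V) id.
  apply/eqaddoP => e e0; move/eqaddoP: fE => /(_ e e0) fE.
  have fgx := nbhs_singleton fg.
  have : \forall h \near (0 : V), f (h + x) = g (h + x).
    by move: fg; rewrite (near_shift 0) subr0.
  apply: filterS2 fE => h /[swap]; rewrite /= !fctE /= -fgx => <-.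
  by [].
have dE := diff_unique dfc gE.
by apply/diff_locallyP; rewrite dE.
Qed.

Lemma near_open (T : topologicalType) (z : T) (P : set T) :
  (\forall w \near z, P w) -> exists O, [/\ open O, O z & O `<=` P].
Proof.
by move=> zP; exists P°; split; [exact: open_interior| |exact: interior_subset].
Qed.

(** * Directional derivatives of functions of row vectors *)

Section Directional.
Context {R : realType}.

Lemma differentiable_rV (V : normedModType R) (p : nat) (T : V -> 'rV[R]_p) z :
  (forall i, differentiable (fun w => T w 0 i) z) -> differentiable T z.
Proof.
move=> dT.
have -> : T = \sum_(i < p) (fun w => T w 0 i *: (delta_mx 0 i : 'rV[R]_p)).
  by apply/funext => w; rewrite [LHS]row_sum_delta fct_sumE.
by apply: differentiable_sum => i; apply: differentiableZl.
Qed.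

Lemma derive_row_sum (p : nat) (f : 'rV[R]_p -> R) z (v : 'rV[R]_p) :
  differentiable f z -> 'D_v f z = \sum_(i < p) v 0 i * 'D_('e_i) f z.
Proof.
move=> df; rewrite deriveE // {1}(row_sum_delta v) linear_sum.
by apply: eq_bigr => i _; rewrite linearZ -deriveE.
Qed.

Lemma derive_coord (p : nat) (i : 'I_p) (v z : 'rV[R]_p) :
  'D_v (fun w : 'rV[R]_p => w 0 i) z = v 0 i.
Proof.
have di : derivable (id : 'rV[R]_p -> _) z v by exact: derivable_id.
have := derive_mx di; rewrite derive_id => /(congr1 (fun M : 'rV__ => M 0 i)).
by rewrite mxE.
Qed.

Lemma derive_comp_row (V : normedModType R) (p : nat) (T : V -> 'rV[R]_p)
    (g : 'rV[R]_p -> R) z v :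
  (forall i, differentiable (fun w => T w 0 i) z) -> differentiable g (T z) ->
  'D_v (g \o T) z = 'D_(\row_i 'D_v (fun w => T w 0 i) z) g (T z).
Proof.
move=> dT dg; have dT' := differentiable_rV dT.
rewrite deriveE; last exact: differentiable_comp.
rewrite diff_comp //= -!deriveE //; congr ('D_ _ g _).
by rewrite derive_mx; [apply/rowP => i; rewrite !mxE|exact: diff_derivable].
Qed.

End Directional.

(** * Closure of smoothness under sums, products, composition and derivatives *)

Section SmoothClosure.
Context {R : realType}.

(* A class that contains the smooth functions and is closed under the operations
   of interest and, by construction, under directional derivatives: it is the
   invariant of the induction over the lists of directions in [smooth_on]. *)
Inductive smooth_gen (m : nat) (O : set 'rV[R]_m) : ('rV[R]_m -> R) -> Prop :=
| gen_base f : smooth_on O f -> smooth_gen O f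
| gen_cst k : smooth_gen O (fun=> k)
| gen_coord i : smooth_gen O (fun z => z 0 i)
| gen_add f g : smooth_gen O f -> smooth_gen O g ->
    smooth_gen O (fun z => f z + g z)
| gen_mul f g : smooth_gen O f -> smooth_gen O g ->
    smooth_gen O (fun z => f z * g z)
| gen_comp p (O' : set 'rV[R]_p) g (T : 'rV[R]_m -> 'rV[R]_p) :
    smooth_on O' g -> (forall i, smooth_gen O (fun z => T z 0 i)) ->
    (forall z, O z -> O' (T z)) -> smooth_gen O (fun z => g (T z)).

Lemma smooth_onD m (O : set 'rV[R]_m) f v :
  smooth_on O f -> smooth_on O ('D_v f).
Proof. by move=> sf vs z Oz; have := sf (rcons vs v) z Oz; rewrite foldr_rcons. Qed.

Context {m : nat} {O : set 'rV[R]_m}.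

Lemma gen_sum (I : Type) (s : seq I) (f : I -> 'rV[R]_m -> R) :
  (forall i, smooth_gen O (f i)) -> smooth_gen O (fun z => \sum_(i <- s) f i z).
Proof.
move=> fO; elim: s => [|i s IH].
  rewrite (_ : (fun _ => _) = fun=> 0); first exact: gen_cst.
  by apply/funext => z; rewrite big_nil.
rewrite (_ : (fun _ => _) = fun z => f i z + \sum_(j <- s) f j z).
  exact: gen_add.
by apply/funext => z; rewrite big_cons.
Qed.

Lemma gen_diff f : smooth_gen O f -> forall z, O z -> differentiable f z.
Proof.
elim=> {f} => [f sf|k|i|f g _ df _ dg|f g _ df _ dg|p O' g T sg _ dT OT] z Oz.
- exact: sf [::] z Oz.
- exact: differentiable_cst.
- exact: differentiable_coord.
- exact: differentiableD (df z Oz) (dg z Oz).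
- exact: differentiableM (df z Oz) (dg z Oz).
- apply: (@differentiable_comp _ _ _ _ T g).
    by apply: differentiable_rV => i; exact: dT.
  exact: sg [::] _ (OT _ Oz).
Qed.

(** The derivative is matched with a member of the class only on [O], since the differentiability
    behind the sum, product and chain rules is known only there. *)
Lemma gen_derive f v : smooth_gen O f ->
  exists2 f', smooth_gen O f' & forall z, O z -> 'D_v f z = f' z.
Proof.
elim=> {f}.
- by move=> f sf; exists ('D_v f) => //; apply/gen_base/smooth_onD.
- by move=> k; exists (fun=> 0) => [|z _]; [exact: gen_cst|exact: derive_cst].
- by move=> i; exists (fun=> v 0 i) => [|z _]; [exact: gen_cst|exact: derive_coord].
- move=> f g sf [f' sf' ff'] sg [g' sg' gg']; 
  exists (fun z => f' z + g' z); first exact: gen_add.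
  move=> z Oz; rewrite -ff' // -gg' //.
  by apply: (@deriveD _ _ _ f g); apply: diff_derivable; exact: gen_diff.
- move=> f g sf [f' sf' ff'] sg [g' sg' gg'].
  exists (fun z => f z * g' z + g z * f' z); first by apply: gen_add; exact: gen_mul.
  move=> z Oz; rewrite -ff' // -gg' //.
  by apply: (@deriveM _ _ f g); apply: diff_derivable; exact: gen_diff.
- move=> p O' g T sg sT IH OT.
  have {}IH i : exists f', smooth_gen O f' /\
      forall z, O z -> 'D_v (fun w => T w 0 i) z = f' z.
    by have [f' ? ?] := IH i; exists f'.
  have [T' T'P] := boolp.choice IH.
  (* Chain rule; the partial derivatives of [g] are again smooth on [O'], so [gen_comp] applies to
     each of them. *)
  exists (fun z => \sum_(i < p) T' i z * 'D_('e_i) g (T z)).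
    apply: gen_sum => i; apply: gen_mul; first exact: (T'P i).1.
    by apply: (@gen_comp _ _ _ O' ('D_('e_i) g)) => //; exact: smooth_onD.
  move=> z Oz; have dT i : differentiable (fun w => T w 0 i) z by exact: gen_diff.
  have dg : differentiable g (T z) by apply: (sg [::]); exact: OT.
  rewrite -[LHS]/('D_v (g \o T) z) derive_comp_row // derive_row_sum //.
  by apply: eq_bigr => i _; rewrite mxE (T'P i).2.
Qed.

(** By induction on the directions, each iterated derivative agrees on [O] with a member of the
    class. As [O] is open, this agreement passes to derivatives and to differentiability. *)
Lemma gen_smooth f : open O -> smooth_gen O f -> smooth_on O f.
Proof.
move=> oO sf vs.
have [f' sf' ff'] : exists2 f', smooth_gen O f' &
    forall z, O z -> foldr (fun v (g : 'rV[R]_m -> R) => 'D_v g) f vs z = f' z.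
  elim: vs => [|v vs [f' sf' ff']]; first by exists f.
  have [f'' sf'' ff''] := gen_derive v sf'; exists f'' => // z Oz /=.
  rewrite -ff'' //; apply: near_eq_derive.
  by apply: filterS (open_nbhs_nbhs (conj oO Oz)) => w Ow; exact: ff'.
move=> z Oz; apply: (@near_eq_differentiable _ _ _ f'); last exact: gen_diff.
by apply: filterS (open_nbhs_nbhs (conj oO Oz)) => w Ow; rewrite ff'.
Qed.

End SmoothClosure.

(** * Germs of smooth functions *)

Section SmoothNear.
Context {R : realType} {m : nat}.
Implicit Types (z : 'rV[R]_m) (f g : 'rV[R]_m -> R).

Lemma smooth_onS (O P : set 'rV[R]_m) f : P `<=` O -> smooth_on O f -> smooth_on P f.
Proof. by move=> PO sf vs z /PO; exact: sf. Qed.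

Lemma smooth_near_near z f : smooth_near z f -> \forall w \near z, smooth_near w f.
Proof.
move=> [ O [oO Oz sf]]; apply: filterS (open_nbhs_nbhs (conj oO Oz)) => w Ow.
by exists O.
Qed.

Lemma smooth_near_eq z f g : (\forall w \near z, f w = g w) ->
  smooth_near z f -> smooth_near z g.
Proof.
move=> /near_open [P [oP Pz fg]] [ O [oO Oz sf]].
have oOP : open (O `&` P) by exact: openI.
exists (O `&` P); split=> // vs w OPw.
have E vs' w' : (O `&` P) w' -> foldr (fun v (g : 'rV[R]_m -> R) => 'D_v g) g vs' w' =
    foldr (fun v (g : 'rV[R]_m -> R) => 'D_v g) f vs' w'.
  elim: vs' w' => [|v vs' IH] w' OPw' /=; first by rewrite fg //; case: OPw'.
  apply: near_eq_derive; apply: filterS (open_nbhs_nbhs (conj oOP OPw')) => x; exact: IH.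
apply: (@near_eq_differentiable _ _ _ (foldr (fun v (g : 'rV[R]_m -> R) => 'D_v g) f vs)).
  by apply: filterS (open_nbhs_nbhs (conj oOP OPw)) => x /E ->.
by apply: sf; case: OPw.
Qed.

Lemma smooth_near_cst z k : smooth_near z (fun=> k).
Proof.
exists setT; split=> //; first exact: openT.
by apply: gen_smooth; [exact: openT|exact: gen_cst].
Qed.

Lemma smooth_near_coord z i : smooth_near z (fun w => w 0 i).
Proof.
exists setT; split=> //; first exact: openT.
by apply: gen_smooth; [exact: openT|exact: gen_coord].
Qed.

Lemma smooth_near2 z f g : smooth_near z f -> smooth_near z g ->
  exists O, [/\ open O, O z, smooth_on O f & smooth_on O g].
Proof.
move=> [ O [oO Oz sf]] [P [oP Pz sg]]; exists (O `&` P); split=> //; first exact: openI.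
  exact: smooth_onS sf.
exact: smooth_onS sg.
Qed.

Lemma smooth_nearD z f g : smooth_near z f -> smooth_near z g ->
  smooth_near z (fun w => f w + g w).
Proof.
move=> /smooth_near2 h /h [ O [oO Oz sf sg]]; exists O; split=> //.
by apply: gen_smooth => //; apply: gen_add; exact: gen_base.
Qed.

Lemma smooth_nearM z f g : smooth_near z f -> smooth_near z g ->
  smooth_near z (fun w => f w * g w).
Proof.
move=> /smooth_near2 h /h [ O [oO Oz sf sg]]; exists O; split=> //.
by apply: gen_smooth => //; apply: gen_mul; exact: gen_base.
Qed.

Lemma smooth_near_comp p z (g : 'rV[R]_p -> R) (T : 'rV[R]_m -> 'rV[R]_p) :
  smooth_near (T z) g -> (forall i, smooth_near z (fun w => T w 0 i)) ->
  smooth_near z (g \o T).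
Proof.
move=> [ O' [oO' O'z sg]] sT.
have [ O OP] := boolp.choice sT.
have cT : {for z, continuous T}.
  apply: differentiable_continuous; apply: differentiable_rV => i.
  by have [_ Oz sTi] := OP i; exact: sTi [::] z Oz.
have : \forall w \near z, O' (T w) /\ forall i, O i w.
  apply: filterI; first by apply: cT; exact: open_nbhs_nbhs.
  (* There are finitely many coordinates, so the sets where they are smooth share a neighbourhood of
     [z]. *)
  apply: (@filter_forall _ _ O (nbhs z)) => i.
  by have [? ? _] := OP i; exact: open_nbhs_nbhs.
move=> /near_open [P [oP Pz PO]].
exists P; split=> //; apply: gen_smooth => //; apply: (@gen_comp _ _ _ _ O' g T) => //.
  by move=> i; apply: gen_base; have [_ _] := OP i; apply: smooth_onS => w /PO [].
by move=> w /PO [].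
Qed.

Lemma smooth_near_derive z v f : smooth_near z f -> smooth_near z ('D_v f).
Proof. by move=> [ O [? ? ?]]; exists O; split=> //; exact: smooth_onD. Qed.

Lemma smooth_near_sum z (I : Type) (s : seq I) (f : I -> 'rV[R]_m -> R) :
  (forall i, smooth_near z (f i)) -> smooth_near z (fun w => \sum_(i <- s) f i w).
Proof.
move=> sf; elim: s => [|i s IH].
  rewrite (_ : (fun _ => _) = fun=> 0); last by apply/funext => w; rewrite big_nil.
  exact: smooth_near_cst.
rewrite (_ : (fun _ => _) = fun w => f i w + \sum_(j <- s) f j w); first exact: smooth_nearD.
by apply/funext => w; rewrite big_cons.
Qed.

End SmoothNear.

(** ** Symmetry of second derivatives *)

Section Schwarz.
Context {R : realType} {m : nat}.

Lemma is_derive_line (V : normedModType R) (f : V -> R) (z v : V) (t : R) :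
  differentiable f (z + t *: v) ->
  is_derive t 1 (fun s => f (z + s *: v)) ('D_v f (z + t *: v)).
Proof.
move=> df; pose l (s : R) : V := z + s *: v.
have dl : is_diff t l ( *:%R^~ v).
  rewrite -[ *:%R^~ v]add0r; exact: is_diffD.
have ex_dl : differentiable l t by exact: ex_diff.
have dk : differentiable (f \o l) t by exact: differentiable_comp.
apply: DeriveDef; first exact: diff_derivable.
by rewrite deriveE // diff_comp //= diff_val scale1r -deriveE.
Qed.

Lemma MVT_diff (k k' : R -> R) (h : R) : 0 < h ->
  (forall t, 0 <= t <= h -> is_derive t 1 k (k' t)) ->
  exists2 c, 0 < c < h & k h - k 0 = k' c * h.
Proof.
move=> h0 dk.
have [x xh||c ch E] := @MVT R k k' 0 h h0.
- by apply: dk; move: xh; rewrite in_itv /= => /andP[/ltW -> /ltW].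
- apply: derivable_within_continuous => t; rewrite in_itv /= => th.
  by have /@ex_derive := dk t th.
- by exists c; [move: ch; rewrite in_itv|rewrite E subr0].
Qed.

(** The mixed increment over the parallelogram spanned by [v] and [w]. It is symmetric in [v] and
    [w], and to second order it is either mixed derivative. *)
Definition second_difference (f : 'rV[R]_m -> R) (z v w : 'rV[R]_m) : R :=
  f (z + v + w) - f (z + v) - (f (z + w) - f z).

Lemma second_differenceC f z v w :
  second_difference f z v w = second_difference f z w v.
Proof.
rewrite /second_difference (addrAC z w) !opprB addrACA [RHS]addrACA.
by rewrite [- f (z + v) + _]addrC.
Qed.

(** Two mean value theorems: along [v] for the increment [k] of [f] in the direction [h *: w], then
    along [w] for ['D_v f]. *)
Lemma second_difference_mean (O : set 'rV[R]_m) f z v w (h : R) :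
  smooth_on O f -> 0 < h ->
  (forall s t, 0 <= s <= h -> 0 <= t <= h -> O (z + s *: v + t *: w)) ->
  exists s t, [/\ 0 < s < h, 0 < t < h &
    second_difference f z (h *: v) (h *: w)
      = 'D_w ('D_v f) (z + s *: v + t *: w) * h * h].
Proof.
move=> sf h0 Oh; have hh : 0 <= h <= h by rewrite ltW /=.
have h00 : (0 : R) <= 0 <= h by rewrite lexx /= ltW.
have O0 s : 0 <= s <= h -> O (z + s *: v).
  by move=> sh; have := Oh s 0 sh h00; rewrite scale0r addr0.
pose k s := f (z + s *: v + h *: w) - f (z + s *: v).
pose k' s := 'D_v f (z + s *: v + h *: w) - 'D_v f (z + s *: v).
have [|s sh ks] := @MVT_diff k k' h h0.
  move=> s sh; apply: is_deriveB; last by apply: is_derive_line; apply: (sf [::]); exact: O0.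
  have E x : z + x *: v + h *: w = z + h *: w + x *: v by rewrite addrAC.
  rewrite E; under eq_fun do rewrite E; apply: is_derive_line.
  by apply: (sf [::]); rewrite -E; exact: Oh.
have sh' : 0 <= s <= h by case/andP: sh => /ltW -> /ltW.
have [|t th kt] := @MVT_diff (fun t => 'D_v f (z + s *: v + t *: w))
   (fun t => 'D_w ('D_v f) (z + s *: v + t *: w)) h h0.
  by move=> t th; apply: is_derive_line; apply: (sf [:: v]); exact: Oh.
exists s, t; split=> //; rewrite -kt scale0r addr0 -/(k' s) -ks /k /second_difference.
by rewrite !scale0r !addr0.
Qed.

(** Both mixed derivatives, taken at suitable points of a small parallelogram, equal the same second
    difference divided by [h * h]. By continuity each is within [e / 2] of its value at [z]. *)
Lemma derive_comm z f (v w : 'rV[R]_m) : smooth_near z f ->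
  'D_w ('D_v f) z = 'D_v ('D_w f) z.
Proof.
move=> [ O [oO Oz sf]]; apply/eqP; rewrite -subr_eq0 -normr_le0.
apply/ler_addgt0Pl => e e0; rewrite addr0.
have e20 : 0 < e / 2 by rewrite divr_gt0.
have c1 : {for z, continuous ('D_w ('D_v f))}.
  by apply: differentiable_continuous; exact: sf [:: w; v] z Oz.
have c2 : {for z, continuous ('D_v ('D_w f))}.
  by apply: differentiable_continuous; exact: sf [:: v; w] z Oz.
have : \forall x \near z, [/\ O x, `|'D_w ('D_v f) z - 'D_w ('D_v f) x| < e / 2
    & `|'D_v ('D_w f) z - 'D_v ('D_w f) x| < e / 2].
  have n1 : \forall x \near z, `|'D_w ('D_v f) z - 'D_w ('D_v f) x| < e / 2.
    exact: (cvgrPdist_lt _ _).1 c1 _ e20.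
  have n2 : \forall x \near z, `|'D_v ('D_w f) z - 'D_v ('D_w f) x| < e / 2.
    exact: (cvgrPdist_lt _ _).1 c2 _ e20.
  have n3 : \forall x \near z, O x by exact: open_nbhs_nbhs.
  by apply: filterS3 n3 n1 n2 => x Ox A B; split.
move=> /nbhs_ballP [d /= d0 dP].
(* With this choice [h + h * |v| + h * |w| = d]; the spare summand [h] keeps the whole parallelogram
   strictly inside the ball of radius [d]. *)
pose h := d / (1 + `|v| + `|w|).
have n0 : 0 < 1 + `|v| + `|w| by rewrite -addrA ltr_pwDl // addr_ge0.
have h0 : 0 < h by rewrite divr_gt0.
have inb s t : 0 <= s <= h -> 0 <= t <= h -> ball z d (z + s *: v + t *: w).
  move=> /andP[s0 sh] /andP[t0 th]; rewrite -ball_normE /= -addrA opprD addNKr normrN.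
  apply: le_lt_trans (ler_normD _ _) _; rewrite !normrZ !ger0_norm //.
  have hE : d = h + h * `|v| + h * `|w|.
    by rewrite -{1}(mulr1 h) -!mulrDr divfK // gt_eqF.
  by rewrite hE -addrA ltr_pwDl //; apply: lerD; apply: ler_wpM2r.
have inO s t : 0 <= s <= h -> 0 <= t <= h -> O (z + s *: v + t *: w).
  by move=> sh th; have [] := dP _ (inb _ _ sh th).
have inO' s t : 0 <= s <= h -> 0 <= t <= h -> O (z + s *: w + t *: v).
  by move=> sh th; rewrite addrAC; exact: inO.
have [s [t [sh th E1]]] := second_difference_mean sf h0 inO.
have [s' [t' [sh' th' E2]]] := second_difference_mean sf h0 inO'.
have W x : 0 < x < h -> 0 <= x <= h by case/andP => /ltW -> /ltW.
have [_ A _] := dP _ (inb _ _ (W _ sh) (W _ th)).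
have [_ _ B] := dP _ (inb _ _ (W _ th') (W _ sh')).
rewrite (addrAC z) in B.
have E : 'D_w ('D_v f) (z + s *: v + t *: w) = 'D_v ('D_w f) (z + s' *: w + t' *: v).
  have hn : h != 0 by rewrite gt_eqF.
  have EE := etrans (esym E1) (etrans (second_differenceC _ _ _ _) E2).
  exact: (@mulIf R h hn _ _ (@mulIf R h hn _ _ EE)).
rewrite E in A; rewrite distrC in B; rewrite (splitr e).
exact: le_trans (ler_distD _ _ _) (ltW (ltrD A B)).
Qed.

End Schwarz.

(** * Functions, tangent vectors and Lie brackets in charts *)

Section Charts.
Context {R : realType} {m : nat} {C : charted R m}.
Implicit Types (c d : chart R m C) (p q : C) (f : C -> R).

(* [smooth_manifold] without the Hausdorff and paracompactness conditions, which
   are irrelevant to local calculus and need not be transferred to [TM]. *)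
Record smooth_atlas : Prop := SmoothAtlas {
  atlas_open : forall c, atlas C c -> open (chart_dom c) ;
  atlas_inj : forall c, atlas C c ->
    forall p q, chart_dom c p -> chart_dom c q -> c p = c q -> p = q ;
  atlas_continuous : forall c, atlas C c ->
    forall p, chart_dom c p -> {for p, continuous c} ;
  atlas_open_map : forall c, atlas C c ->
    forall A, open A -> A `<=` chart_dom c -> open (c @` A) ;
  atlas_covers : forall p : C, exists2 c, atlas C c & chart_dom c p ;
  atlas_smooth : forall c d, atlas C c -> atlas C d ->
    forall p, chart_dom c p -> chart_dom d p ->
    forall i, smooth_in c (fun q => d q 0 i) p }.

Lemma smooth_manifold_atlas : smooth_manifold C -> smooth_atlas.
Proof. by case. Qed.

(** A coordinate expression of the germ of [f] at [p]; away from [c p] the function [g] is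
    arbitrary. *)
Definition is_rep c p f (g : 'rV[R]_m -> R) : Prop :=
  smooth_near (c p) g /\ \forall q \near p, f q = g (c q).

Hypothesis HC : smooth_atlas.

Lemma near_chart c p (P : set C) : atlas C c -> chart_dom c p ->
  (\forall q \near p, P q) ->
  \forall z \near c p, exists q, [/\ chart_dom c q, c q = z & P q].
Proof.
move=> Cc cp /near_open [ O [oO Op OP]].
have oOc : open (O `&` chart_dom c) by apply: openI => //; exact: atlas_open.
have oI := atlas_open_map HC Cc oOc (@subIsetr _ _ _).
apply: filterS (open_nbhs_nbhs (conj oI (ex_intro2 _ _ p (conj Op cp) erefl))).
by move=> _ [q [Oq cq] <-]; exists q; split=> //; exact: OP.
Qed.

Lemma near_dom c p : atlas C c -> chart_dom c p -> \forall q \near p, chart_dom c q.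
Proof. by move=> Cc cp; apply: open_nbhs_nbhs; split=> //; exact: atlas_open. Qed.

Lemma near_rep c p f g : atlas C c -> chart_dom c p -> is_rep c p f g ->
  \forall q \near p, is_rep c q f g.
Proof.
move=> Cc cp [sg fg]; have cc := atlas_continuous HC Cc cp.
have sg' : \forall q \near p, smooth_near (c q) g by exact: cc _ (smooth_near_near sg).
have fg' : \forall q \near p, \forall q' \near q, f q' = g (c q') by exact: near_join.
by apply: filterS2 sg' fg' => q ? ?; split.
Qed.

Lemma rep_exists c p f : atlas C c -> chart_dom c p -> smooth_at f p ->
  exists g, is_rep c p f g.
Proof. by move=> Cc cp /(_ c Cc cp) [g ? ?]; exists g. Qed.

Lemma rep_coord c p i : is_rep c p (fun q => c q 0 i) (fun z => z 0 i).
Proof. by split; [exact: smooth_near_coord|near=> q]. Unshelve. all: by end_near. Qed.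

Lemma transition_rep c d p : atlas C c -> atlas C d -> chart_dom c p -> chart_dom d p ->
  exists T : 'rV[R]_m -> 'rV[R]_m,
    (forall i, smooth_near (c p) (fun z => T z 0 i)) /\
    (\forall q \near p, d q = T (c q)).
Proof.
move=> Cc Cd cp dp.
have TE i : exists g, is_rep c p (fun q => d q 0 i) g.
  by have [g ? ?] := atlas_smooth HC Cc Cd cp dp i; exists g.
have [T TP] := boolp.choice TE.
exists (fun z => \row_i T i z); split=> [i|].
  by under eq_fun do rewrite mxE; exact: (TP i).1.
have dT : \forall q \near p, forall i, d q 0 i = T i (c q).
  by apply: filter_forall => i; exact: (TP i).2.
by apply: filterS dT => q dT; apply/rowP => i; rewrite mxE.
Qed.

Lemma rep_change c d p f g : atlas C c -> atlas C d -> chart_dom c p -> chart_dom d p ->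
  is_rep d p f g ->
  exists T : 'rV[R]_m -> 'rV[R]_m,
    [/\ forall i, smooth_near (c p) (fun z => T z 0 i), d p = T (c p)
      & is_rep c p f (g \o T)].
Proof.
move=> Cc Cd cp dp [sg fg]; have [T [sT dT]] := transition_rep Cc Cd cp dp.
have dpT := nbhs_singleton dT.
exists T; split=> //; split; first by apply: smooth_near_comp; rewrite -?dpT.
by apply: filterS2 fg dT => q -> /= ->.
Qed.

(** A representative in one chart suffices, although [smooth_at] asks for one in every chart: the
    others are obtained by composing with transition maps. *)
Lemma rep_smooth_at d p f g : atlas C d -> chart_dom d p -> is_rep d p f g -> smooth_at f p.
Proof.
move=> Cd dp fg c Cc cp; have [T [_ _ [? ?]]] := rep_change Cc Cd cp dp fg.
by exists (g \o T).
Qed.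

Lemma smooth_at_near p f : smooth_at f p -> \forall q \near p, smooth_at f q.
Proof.
have [c Cc cp] := atlas_covers HC p => /(rep_exists Cc cp) [g fg].
by apply: filterS2 (near_dom Cc cp) (near_rep Cc cp fg) => q; exact: rep_smooth_at.
Qed.

Lemma rep_eq c p f f' g : (\forall q \near p, f q = f' q) -> is_rep c p f g -> is_rep c p f' g.
Proof. by move=> ff' [sg fg]; split=> //; apply: filterS2 ff' fg => q ->. Qed.

Lemma smooth_at_eq p f f' : (\forall q \near p, f q = f' q) -> smooth_at f p -> smooth_at f' p.
Proof.
move=> ff' sf c Cc cp; have [g ? fg] := sf c Cc cp; exists g => //.
by apply: filterS2 ff' fg => q ->.
Qed.

Lemma smooth_coord c p i : atlas C c -> chart_dom c p -> smooth_at (fun q => c q 0 i) p.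
Proof. by move=> Cc cp; exact: rep_smooth_at Cc cp (rep_coord _ _ _). Qed.

Lemma smooth_at_chart_comp c p g : atlas C c -> chart_dom c p -> smooth_near (c p) g ->
  smooth_at (fun q => g (c q)) p.
Proof.
move=> Cc cp sg; apply: (rep_smooth_at Cc cp (g := g)); split=> //.
by near=> q. Unshelve. all: by end_near. Qed.

Lemma rep_cst c p k : is_rep c p (fun=> k) (fun=> k).
Proof. by split; [exact: smooth_near_cst|near=> q]. Unshelve. all: by end_near. Qed.

Lemma repD c p f f' g g' : is_rep c p f g -> is_rep c p f' g' ->
  is_rep c p (fun q => f q + f' q) (fun z => g z + g' z).
Proof.
move=> [sg fg] [sg' fg']; split; first exact: smooth_nearD.
by apply: filterS2 fg fg' => q -> ->.
Qed.

Lemma repM c p f f' g g' : is_rep c p f g -> is_rep c p f' g' ->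
  is_rep c p (fun q => f q * f' q) (fun z => g z * g' z).
Proof.
move=> [sg fg] [sg' fg']; split; first exact: smooth_nearM.
by apply: filterS2 fg fg' => q -> ->.
Qed.

Lemma smooth_cst p k : smooth_at (fun=> k) p.
Proof. by have [c Cc cp] := atlas_covers HC p; exact: rep_smooth_at Cc cp (rep_cst _ _ _). Qed.

Lemma smoothD p f f' : smooth_at f p -> smooth_at f' p -> smooth_at (fun q => f q + f' q) p.
Proof.
have [c Cc cp] := atlas_covers HC p.
move=> /(rep_exists Cc cp) [g fg] /(rep_exists Cc cp) [g' fg'].
exact: rep_smooth_at Cc cp (repD fg fg').
Qed.

Lemma smoothM p f f' : smooth_at f p -> smooth_at f' p -> smooth_at (fun q => f q * f' q) p.
Proof.
have [c Cc cp] := atlas_covers HC p.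
move=> /(rep_exists Cc cp) [g fg] /(rep_exists Cc cp) [g' fg'].
exact: rep_smooth_at Cc cp (repM fg fg').
Qed.

Lemma smooth_sum p (I : Type) (s : seq I) (f : I -> C -> R) :
  (forall i, smooth_at (f i) p) -> smooth_at (fun q => \sum_(i <- s) f i q) p.
Proof.
move=> sf; elim: s => [|i s IH].
  rewrite (_ : (fun _ => _) = fun=> 0); last by apply/funext => w; rewrite big_nil.
  exact: smooth_cst.
rewrite (_ : (fun _ => _) = fun w => f i w + \sum_(j <- s) f j w); first exact: smoothD.
by apply/funext => w; rewrite big_cons.
Qed.

(** * Tangent vectors in coordinates *)

Definition coords c p (X : tangent p) : 'rV[R]_m := \row_i X (fun q => c q 0 i).

Lemma tangent_nonsmooth p (X : tangent p) f : ~ smooth_at f p -> X f = 0.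
Proof. by have /asboolP [+ _] := tangentP X => /(_ f). Qed.

(** The direction that [is_tangent] provides for the chart is found by evaluating [X] on the
    coordinate functions: it is [coords c X]. *)
Lemma tangentE c p (X : tangent p) f g : atlas C c -> chart_dom c p -> is_rep c p f g ->
  X f = 'D_(coords c X) g (c p).
Proof.
move=> Cc cp fg; have /asboolP [_ /(_ c Cc cp) [a Xa]] := tangentP X.
rewrite (_ : coords c X = a).
  by case: (fg) => ? ?; apply: Xa => //; exact: rep_smooth_at fg.
apply/rowP => i; rewrite mxE (Xa _ (smooth_coord i Cc cp) (fun z => z 0 i)) ?derive_coord //.
  exact: smooth_near_coord.
by near=> q. Unshelve. all: by end_near. Qed.

Lemma tangentE_sum c p (X : tangent p) f g : atlas C c -> chart_dom c p -> is_rep c p f g ->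
  X f = \sum_i X (fun q => c q 0 i) * 'D_('e_i) g (c p).
Proof.
move=> Cc cp fg; rewrite (tangentE X Cc cp fg) derive_row_sum.
  by apply: eq_bigr => i _; rewrite mxE.
by apply: smooth_near_differentiable; case: fg.
Qed.

Lemma tangent_ext c p (X Y : tangent p) : atlas C c -> chart_dom c p ->
  (forall i, X (fun q => c q 0 i) = Y (fun q => c q 0 i)) -> X = Y.
Proof.
move=> Cc cp XY; apply: val_inj; apply/funext => f /=.
have [/(rep_exists Cc cp) [g fg]|nf] := pselect (smooth_at f p); last by rewrite !tangent_nonsmooth.
by rewrite !(tangentE_sum _ Cc cp fg); apply: eq_bigr => i _; rewrite XY.
Qed.

(** This holds without smoothness of [f]: functions equal near [p] are smooth together, and [X] is 0
    on those that are not smooth. *)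
Lemma tangent_eq p (X : tangent p) f f' : (\forall q \near p, f q = f' q) -> X f = X f'.
Proof.
move=> ff'; have [sf|nf] := pselect (smooth_at f p).
  have [c Cc cp] := atlas_covers HC p; have [g fg] := rep_exists Cc cp sf.
  by rewrite (tangentE X Cc cp fg) (tangentE X Cc cp (rep_eq ff' fg)).
rewrite !tangent_nonsmooth // => sf'; apply: nf; apply: smooth_at_eq sf'.
by apply: filterS ff' => q ->.
Qed.

Lemma tangent0E p f : (0 : tangent p) f = 0.
Proof. by rewrite -[LHS]/((val (0 : tangent p)) f) raddf0. Qed.

Lemma tangentDE p (X Y : tangent p) f : (X + Y) f = X f + Y f.
Proof. by rewrite -[LHS]/((val (X + Y)) f) raddfD. Qed.

Lemma tangentZE p k (X : tangent p) f : (k *: X) f = k * X f.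
Proof. by rewrite -[LHS]/((val (k *: X)) f) linearZ. Qed.

Section Derivation.
Variables (p : C) (X : tangent p).

Lemma tangent_cst k : X (fun=> k) = 0.
Proof.
have [c Cc cp] := atlas_covers HC p.
by rewrite (tangentE X Cc cp (rep_cst _ _ _)) derive_cst.
Qed.

Lemma tangentD f f' : smooth_at f p -> smooth_at f' p ->
  X (fun q => f q + f' q) = X f + X f'.
Proof.
have [c Cc cp] := atlas_covers HC p.
move=> /(rep_exists Cc cp) [g fg] /(rep_exists Cc cp) [g' fg'].
rewrite (tangentE X Cc cp (repD fg fg')) (tangentE X Cc cp fg) (tangentE X Cc cp fg').
by apply: (@deriveD _ _ _ g g'); apply/diff_derivable/smooth_near_differentiable;
  [case: fg|case: fg'].
Qed.

Lemma tangentM f f' : smooth_at f p -> smooth_at f' p ->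
  X (fun q => f q * f' q) = f p * X f' + f' p * X f.
Proof.
have [c Cc cp] := atlas_covers HC p.
move=> /(rep_exists Cc cp) [g fg] /(rep_exists Cc cp) [g' fg'].
rewrite (tangentE X Cc cp (repM fg fg')) (tangentE X Cc cp fg) (tangentE X Cc cp fg').
rewrite (nbhs_singleton fg.2) (nbhs_singleton fg'.2).
by apply: (@deriveM _ _ g g'); apply/diff_derivable/smooth_near_differentiable;
  [case: fg|case: fg'].
Qed.

Lemma tangent_fsum (I : Type) (s : seq I) (f : I -> C -> R) :
  (forall i, smooth_at (f i) p) ->
  X (fun q => \sum_(i <- s) f i q) = \sum_(i <- s) X (f i).
Proof.
move=> sf; elim: s => [|i s IH].
  rewrite big_nil (_ : (fun _ => _) = fun=> 0) ?tangent_cst //.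
  by apply/funext => w; rewrite big_nil.
rewrite (_ : (fun _ => _) = fun w => f i w + \sum_(j <- s) f j w).
  by rewrite tangentD ?big_cons ?IH //; exact: smooth_sum.
by apply/funext => w; rewrite big_cons.
Qed.

End Derivation.

(** It is enough to be a directional derivative in one chart: in another chart the direction is the
    image of [a] under the differential of the transition map. *)
Lemma tangent_of_is_tangent c p (v : (C -> R) -> R) (a : 'rV[R]_m) :
  atlas C c -> chart_dom c p ->
  (forall f g, is_rep c p f g -> v f = 'D_a g (c p)) ->
  is_tangent p (fun f => if `[< smooth_at f p >] then v f else 0 : R^o).
Proof.
move=> Cc cp va; split=> [f nf|d Cd dp]; first by rewrite asboolF.
have [T [sT dT]] := transition_rep Cc Cd cp dp; have dpT := nbhs_singleton dT.
exists (\row_i 'D_a (fun z => T z 0 i) (c p)) => f sf g sg fg; rewrite asboolT //.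
have fgT : is_rep c p f (g \o T).
  split; first by apply: smooth_near_comp; rewrite -?dpT.
  by apply: filterS2 fg dT => q -> /= ->.
rewrite (va _ _ fgT) derive_comp_row -?dpT //.
  by move=> i; exact: smooth_near_differentiable.
exact: smooth_near_differentiable.
Qed.

Lemma tangent_ofE c p (v : (C -> R) -> R) (a : 'rV[R]_m) f :
  atlas C c -> chart_dom c p ->
  (forall f g, is_rep c p f g -> v f = 'D_a g (c p)) ->
  smooth_at f p -> tangent_of p v f = v f.
Proof.
move=> Cc cp va sf; rewrite /tangent_of -[LHS]/((val (insubd (0 : tangent p) _)) f).
rewrite insubdK ?asboolT //.
by apply/asboolP; exact: tangent_of_is_tangent va.
Qed.

(* [f \o c^-1], with junk values outside of the image of [c]. *)
Definition chart_pullback c p f : 'rV[R]_m -> R :=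
  fun z => f (xget p [set q | chart_dom c q /\ c q = z]).

Definition coordvec c p (a : 'rV[R]_m) : tangent p :=
  tangent_of p (fun f => 'D_a (chart_pullback c p f) (c p)).

Lemma chart_pullback_near c p f g : atlas C c -> chart_dom c p -> is_rep c p f g ->
  \forall z \near c p, chart_pullback c p f z = g z.
Proof.
move=> Cc cp [_ fg]; apply: filterS (near_chart Cc cp fg) => z [q [cq <- fq]].
rewrite /chart_pullback -fq; congr f; case: xgetP => [_ -> [cx xq]|/(_ q)]; last by case.
exact: (atlas_inj HC Cc).
Qed.

Lemma coordvecE c p a f g : atlas C c -> chart_dom c p -> is_rep c p f g ->
  coordvec c p a f = 'D_a g (c p).
Proof.
move=> Cc cp fg; have E f' g' : is_rep c p f' g' ->
    'D_a (chart_pullback c p f') (c p) = 'D_a g' (c p).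
  by move=> fg'; apply: near_eq_derive; exact: chart_pullback_near.
by rewrite /coordvec (tangent_ofE Cc cp E) ?(E _ _ fg) //; exact: rep_smooth_at Cc cp fg.
Qed.

Lemma coordvec_coord c p a i : atlas C c -> chart_dom c p ->
  coordvec c p a (fun q => c q 0 i) = a 0 i.
Proof. by move=> Cc cp; rewrite (coordvecE a Cc cp (rep_coord _ _ _)) derive_coord. Qed.

Lemma coordvecK c p (X : tangent p) : atlas C c -> chart_dom c p ->
  coordvec c p (coords c X) = X.
Proof. by move=> Cc cp; apply: (tangent_ext Cc cp) => i; rewrite coordvec_coord // mxE. Qed.

(** * Lie brackets of smooth fields *)

Lemma smooth_field_apply (X : forall q : C, tangent q) u f :
  smooth_field_at X u -> smooth_at f u -> smooth_at (fun q => X q f) u.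
Proof. by move=> /nbhs_singleton; apply. Qed.

(** The product rule applied to [Y f = \sum_i Y^i d_i g]. The second sum pairs the components of [X]
    and [Y] with the Hessian of [g], so it is unchanged when [X] and [Y] are exchanged. *)
Lemma field_derive c (X Y : forall q : C, tangent q) u f g :
  atlas C c -> chart_dom c u -> smooth_field_at Y u -> is_rep c u f g ->
  X u (fun q => Y q f) =
    \sum_i X u (fun q => Y q (fun q' => c q' 0 i)) * 'D_('e_i) g (c u)
    + \sum_i \sum_j Y u (fun q => c q 0 i) * X u (fun q => c q 0 j)
        * 'D_('e_j) ('D_('e_i) g) (c u).
Proof.
move=> Cc cu sY fg.
have sg i : is_rep c u (fun q => 'D_('e_i) g (c q)) ('D_('e_i) g).
  split; first by apply: smooth_near_derive; case: fg.
  by near=> q.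
have sYi i : smooth_at (fun q => Y q (fun q' => c q' 0 i)) u.
  by apply: smooth_field_apply => //; exact: smooth_coord.
have sgi i : smooth_at (fun q => 'D_('e_i) g (c q)) u by exact: rep_smooth_at (sg i).
have YE : \forall q \near u, Y q f =
    \sum_i Y q (fun q' => c q' 0 i) * 'D_('e_i) g (c q).
  apply: filterS2 (near_dom Cc cu) (near_rep Cc cu fg) => q cq fgq.
  exact: tangentE_sum.
rewrite (tangent_eq _ YE) tangent_fsum; last by move=> i; exact: smoothM.
rewrite -big_split; apply: eq_bigr => i _ /=.
rewrite tangentM // [LHS]addrC; congr (_ + _); first exact: mulrC.
rewrite (tangentE_sum _ Cc cu (sg i)) mulr_sumr.
by apply: eq_bigr => j _; rewrite mulrA.
Unshelve. all: by end_near. Qed.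

(** The Hessian terms of [field_derive] cancel by [derive_comm]. What remains is a derivative in the
    direction [a], so [tangent_of] returns the commutator and not its default value. *)
Lemma lie_bracketE (X Y : forall q : C, tangent q) u f :
  smooth_field_at X u -> smooth_field_at Y u -> smooth_at f u ->
  lie_bracket X Y u f = X u (fun q => Y q f) - Y u (fun q => X q f).
Proof.
move=> sX sY sf; have [c Cc cu] := atlas_covers HC u.
pose a := \row_i (X u (fun q => Y q (fun q' => c q' 0 i))
  - Y u (fun q => X q (fun q' => c q' 0 i))).
apply: (tangent_ofE (a := a) Cc cu _ sf) => f' g fg.
rewrite (field_derive X Cc cu sY fg) (field_derive Y Cc cu sX fg).
rewrite derive_row_sum; last by apply: smooth_near_differentiable; case: fg.
rewrite opprD addrACA -!sumrB [X in _ + X](_ : _ = 0) ?addr0.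
  by apply: eq_bigr => i _; rewrite !mxE mulrBl.
rewrite sumrB; apply/eqP; rewrite subr_eq0; apply/eqP.
rewrite exchange_big; apply: eq_bigr => i _; apply: eq_bigr => j _ /=.
rewrite (derive_comm _ _ fg.1); congr (_ * _); exact: mulrC.
Qed.

End Charts.

(** * The tangent bundle as a manifold *)

Section TangentBundleAtlas.
Context {R : realType} {n : nat} {M : charted R n}.
Hypothesis HM : smooth_atlas (C := M).
Implicit Types (c d : chart R n M) (u w : TM M).

Lemma near_lsubmx (x y : 'rV[R]_n) (P : set 'rV[R]_n) :
  (\forall x' \near x, P x') -> \forall z \near row_mx x y, P (lsubmx z).
Proof.
move=> xP; have cl : {for row_mx x y, continuous (@lsubmx R 1 n n)}.
  exact: continuous_lsubmx.
by apply: cl; rewrite row_mxKl.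
Qed.

Lemma near_tchart c u (P : set M) : atlas M c -> chart_dom c (tproj u) ->
  (\forall q \near tproj u, P q) ->
  \forall z \near tchart c u, forall w, chart_dom c (tproj w) -> tchart c w = z -> P (tproj w).
Proof.
move=> Cc cu uP; apply: filterS (near_lsubmx _ (near_chart HM Cc cu uP)) => z.
move=> [q [cq qz Pq]] w cw wz; suff <- : q = tproj w by [].
by apply: (atlas_inj HM Cc) => //; rewrite qz -wz row_mxKl.
Qed.

Lemma open_TME (A : set (TM M)) : open A = tbundle_open A.
Proof. by []. Qed.

Lemma open_tproj (B : set M) : open B -> open [set u : TM M | B (tproj u)].
Proof.
move=> oB; rewrite open_TME => u Bu c Cc cu.
have nB : \forall q \near tproj u, B q by exact: open_nbhs_nbhs.
exact: near_tchart Cc cu nB.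
Qed.

Lemma near_tproj u (P : set M) : (\forall q \near tproj u, P q) ->
  \forall w \near u, P (tproj w).
Proof.
move=> /near_open [ O [oO Ou OP]].
have n1 : \forall w \near u, O (tproj w).
  by apply: open_nbhs_nbhs; split => //; exact: open_tproj.
by apply: filterS n1 => w; exact: OP.
Qed.

(* The map induced on tangent vectors, in the coordinates [(x, y)]: it sends
   [(x, y)] to [(T x, dT_x y)]. *)
Definition prolong (T : 'rV[R]_n -> 'rV[R]_n) (z : 'rV[R]_(n + n)) : 'rV[R]_(n + n) :=
  row_mx (T (lsubmx z)) (\row_i 'D_(rsubmx z) (fun x => T x 0 i) (lsubmx z)).

Lemma smooth_near_prolong (T : 'rV[R]_n -> 'rV[R]_n) (x y : 'rV[R]_n) i :
  (forall j, smooth_near x (fun x => T x 0 j)) ->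
  smooth_near (row_mx x y) (fun z => prolong T z 0 i).
Proof.
move=> sT.
have sl z0 (j : 'I_n) : smooth_near z0 (fun z : 'rV[R]_(n + n) => lsubmx z 0 j).
  by under eq_fun do rewrite mxE; exact: smooth_near_coord.
have sr z0 (j : 'I_n) : smooth_near z0 (fun z : 'rV[R]_(n + n) => rsubmx z 0 j).
  by under eq_fun do rewrite mxE; exact: smooth_near_coord.
rewrite /prolong -(splitK i); case: (fintype.split i) => j /=.
  under eq_fun do rewrite row_mxEl.
  apply: (smooth_near_comp (g := fun x => T x 0 j) (T := @lsubmx R 1 n n)) => //.
  by rewrite row_mxKl.
under eq_fun do rewrite row_mxEr mxE.
pose Tj x := T x 0 j.
(* The direction [rsubmx z] varies with [z]; expanding along the basis leaves derivatives in fixed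
   directions, whose smoothness is known. *)
apply: (@smooth_near_eq _ _ _ (fun z => \sum_k rsubmx z 0 k * 'D_('e_k) Tj (lsubmx z))).
  apply: filterS (near_lsubmx y (smooth_near_near (sT j))) => z sz.
  by rewrite -derive_row_sum //; exact: smooth_near_differentiable.
apply: smooth_near_sum => k; apply: smooth_nearM => //.
apply: (smooth_near_comp (g := 'D_('e_k) Tj) (T := @lsubmx R 1 n n)) => //.
by rewrite row_mxKl; apply: smooth_near_derive; exact: sT.
Qed.

(** The components of [w] in [d] are [w] applied to the coordinates of [d], which [T] represents in
    [c]; this gives [prolong T]. The relation holds on whole fibres over a neighbourhood in [M]. *)
Lemma tchart_transition c d u : atlas M c -> atlas M d ->
  chart_dom c (tproj u) -> chart_dom d (tproj u) ->
  exists T : 'rV[R]_(n + n) -> 'rV[R]_(n + n),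
    (forall i, smooth_near (tchart c u) (fun z => T z 0 i)) /\
    (\forall q \near tproj u, forall w, tproj w = q -> tchart d w = T (tchart c w)).
Proof.
move=> Cc Cd cu du; have [T [sT dT]] := transition_rep HM Cc Cd cu du.
exists (prolong T); split; first by move=> i; exact: smooth_near_prolong.
pose Ti i z := T z 0 i.
have nr : \forall q \near tproj u, forall i, is_rep c q (fun q => d q 0 i) (Ti i).
  apply: filter_forall => i; apply: (near_rep HM Cc cu); split; first exact: sT.
  by apply: filterS dT => q ->.
have ndc := near_dom HM Cc cu.
apply: filterS3 dT nr ndc => q dTq rq cq w wq; rewrite -{q}wq in dTq rq cq *.
rewrite /prolong row_mxKl row_mxKr /=; congr row_mx; first exact: dTq.
apply/rowP => i; rewrite [LHS]mxE [LHS](tangentE HM _ Cc cq (rq i)) [RHS]mxE.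
congr ('D_ _ _ _); apply/rowP => j; rewrite !mxE.
Qed.

(** Openness in the bundle is tested in every induced chart, and there it follows from continuity of
    the transition map. This yields continuity of [tchart c]. *)
Lemma open_tchart_preimage c (B : set 'rV[R]_(n + n)) : atlas M c -> open B ->
  open [set w : TM M | chart_dom c (tproj w) /\ B (tchart c w)].
Proof.
move=> Cc oB; rewrite open_TME => u [cu Bu] d Cd du.
have [T [sT cT]] := tchart_transition Cd Cc du cu.
have dT : {for tchart d u, continuous T}.
  apply: differentiable_continuous; apply: differentiable_rV => i.
  exact: smooth_near_differentiable.
have n1 := near_tchart Cd du (near_dom HM Cc cu).
have n2 := near_tchart Cd du cT.
have n3 : \forall z \near tchart d u, B (T z).
  apply: dT; apply: open_nbhs_nbhs; split => //.
  by rewrite -(nbhs_singleton cT).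
apply: filterS3 n1 n2 n3 => z h1 h2 h3 w dw wz.
by split; [exact: h1 dw wz|rewrite (h2 w dw wz w erefl) wz].
Qed.

Lemma tchart_inj c u w : atlas M c -> chart_dom c (tproj u) -> chart_dom c (tproj w) ->
  tchart c u = tchart c w -> u = w.
Proof.
move=> Cc; case: u w => [p X] [q Y] cp cq /eq_row_mx [pq XY].
have {}pq : p = q by exact: (atlas_inj HM Cc).
(* The base points are identified first, so that the two vectors have the same type. *)
case: q / pq Y cq XY => Y cq XY; congr existT.
apply: (tangent_ext HM Cc cp) => i.
by have := congr1 (fun z : 'rV[R]_n => z 0 i) XY; rewrite !mxE.
Qed.

Lemma tchart_onto c u : atlas M c -> chart_dom c (tproj u) ->
  \forall z \near tchart c u, exists w, chart_dom c (tproj w) /\ tchart c w = z.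
Proof.
move=> Cc cu; have nc := near_chart HM Cc cu (near_dom HM Cc cu).
apply: filterS (near_lsubmx _ nc) => z [q [cq qz _]].
exists (mkTM (coordvec c q (rsubmx z))); split=> //=.
rewrite -[RHS]hsubmxK; congr row_mx => //; apply/rowP => i.
by rewrite mxE (coordvec_coord HM).
Qed.

Lemma TM_atlas : smooth_atlas (C := TM M).
Proof.
split.
- move=> _ [c Cc <-]; apply: open_tproj; exact: atlas_open.
- by move=> _ [c Cc <-] u w cu cw; exact: tchart_inj.
- move=> _ [c Cc <-] u cu B /near_open [ O [oO Ou OB]].
  have n1 : \forall w \near u, chart_dom c (tproj w) /\ O (tchart c w).
    by apply: open_nbhs_nbhs; split => //; exact: open_tchart_preimage.
  by apply: filterS n1 => w [_ /OB].
- move=> _ [c Cc <-] A; rewrite open_TME => oA Ac; rewrite openE => _ [u Au <-].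
  have cu : chart_dom c (tproj u) := Ac _ Au.
  apply: filterS2 (tchart_onto Cc cu) (oA u Au c Cc cu) => z [w [cw wz]] hA.
  by exists w => //; exact: hA.
- move=> u; have [c Cc cu] := atlas_covers HM (tproj u).
  by exists (tchart c) => //; exists c.
- move=> _ _ [c Cc <-] [d Cd <-] u cu du i.
  have [T [sT dT]] := tchart_transition Cc Cd cu du.
  exists (fun z => T z 0 i) => //.
  by apply: filterS (near_tproj dT) => w /(_ w erefl) ->.
Qed.

End TangentBundleAtlas.

(** * Vertical derivatives *)

Section VerticalCalculus.
Context {R : realType} {n : nat} {M : charted R n}.
Hypothesis HM : smooth_atlas (C := M).
Let HT : smooth_atlas (C := TM M) := TM_atlas HM.
Implicit Types (c d : chart R n M) (u w : TM M) (x y : 'rV[R]_n).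

Lemma tchart_atlas c : atlas M c -> atlas (TM M) (tchart c).
Proof. by move=> Cc; exists c. Qed.

Lemma tchart_dom c u : chart_dom c (tproj u) -> chart_dom (tchart c) u.
Proof. by []. Qed.

Lemma rep_tchart_smooth_at c u f g : atlas M c -> chart_dom c (tproj u) ->
  is_rep (C := TM M) (tchart c) u f g -> smooth_at f u.
Proof.
by move=> Cc cu fg; have X := rep_smooth_at HT (tchart_atlas Cc); exact: (X u f g).
Qed.

Lemma rep_tchart_exists c u f : atlas M c -> chart_dom c (tproj u) -> smooth_at f u ->
  exists g, is_rep (C := TM M) (tchart c) u f g.
Proof. by move=> Cc cu; exact: rep_exists (tchart_atlas Cc) (tchart_dom cu). Qed.

Lemma derive_lsubmx (g : 'rV[R]_n -> R) (z v : 'rV[R]_(n + n)) :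
  differentiable g (lsubmx z) -> 'D_v (g \o lsubmx) z = 'D_(lsubmx v) g (lsubmx z).
Proof.
move=> dg; rewrite derive_comp_row //.
  congr ('D_ _ _ _); apply/rowP => i; rewrite !mxE.
  by under eq_fun do rewrite mxE; exact: derive_coord.
by move=> i; under eq_fun do rewrite mxE; exact: differentiable_coord.
Qed.

Lemma rep_tproj c u f g : is_rep c (tproj u) f g ->
  is_rep (C := TM M) (tchart c) u (f \o @tproj R n M) (g \o lsubmx).
Proof.
move=> [sg fg]; split.
  apply: smooth_near_comp; first by rewrite row_mxKl.
  by move=> i; under eq_fun do rewrite mxE; exact: smooth_near_coord.
by apply: filterS (near_tproj HM fg) => w /= ->; rewrite row_mxKl.
Qed.

Lemma smooth_tproj u f : smooth_at f (tproj u) -> smooth_at (f \o @tproj R n M) u.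
Proof.
have [c Cc cu] := atlas_covers HM (tproj u) => /(rep_exists Cc cu) [g /rep_tproj fg].
exact: (rep_tchart_smooth_at Cc cu fg).
Qed.

(** On representatives the functional is the derivative along the first half of the components of
    [X], so [tangent_of] does not fall back to zero. *)
Lemma rhoE u (X : tangent u) f : smooth_at f (tproj u) -> rho X f = X (f \o @tproj R n M).
Proof.
have [c Cc cu] := atlas_covers HM (tproj u) => sf.
apply: (tangent_ofE HM (a := lsubmx (coords (C := TM M) (tchart c) X)) Cc cu _ sf) => f' g fg.
rewrite (tangentE HT X (tchart_atlas Cc) (tchart_dom cu) (rep_tproj fg)) derive_lsubmx row_mxKl //.
by apply: smooth_near_differentiable; case: fg.
Qed.

Lemma tchart_line c u (w : tangent (tproj u)) (t : R) :
  tchart c (mkTM (eta u + t *: w)) = tchart c u + t *: row_mx 0 (coords c w).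
Proof.
rewrite scale_row_mx scaler0 add_row_mx addr0; congr row_mx.
by apply/rowP => i; rewrite !mxE tangentDE tangentZE.
Qed.

Lemma near_line u (w : tangent (tproj u)) (P : set (TM M)) :
  (\forall q \near u, P q) -> \forall t \near (0 : R), P (mkTM (eta u + t *: w)).
Proof.
have [c Cc cu] := atlas_covers HM (tproj u) => nP.
have nz := near_chart HT (tchart_atlas Cc) (tchart_dom cu) nP.
pose v : 'rV[R]_(n + n) := row_mx 0 (coords c w).
have cl : {for (0 : R), continuous (fun t : R => tchart c u + t *: v)}.
  apply: differentiable_continuous.
  have -> : (fun t : R => tchart c u + t *: v) = cst (tchart c u) + ( *:%R^~ v) by [].
  by apply: differentiableD.
have cl0 (Q : set 'rV[R]_(n + n)) : (\forall z \near tchart c u, Q z) ->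
    \forall t \near (0 : R), Q (tchart c u + t *: v).
  by move=> nQ; apply: cl; rewrite scale0r addr0.
apply: filterS (cl0 _ nz) => t [q [cq qz Pq]]; suff <- : q = mkTM (eta u + t *: w) by [].
by apply: (tchart_inj HM Cc) => //; rewrite tchart_line.
Qed.

Lemma is_derive_tchart_line c u (w : tangent (tproj u)) f g :
  atlas M c -> chart_dom c (tproj u) -> is_rep (C := TM M) (tchart c) u f g ->
  is_derive (0 : R) 1 (fun t : R => f (mkTM (eta u + t *: w)))
    ('D_(row_mx 0 (coords c w)) g (tchart c u)).
Proof.
move=> Cc cu fg; pose v : 'rV[R]_(n + n) := row_mx 0 (coords c w).
have dg : differentiable g (tchart c u + 0 *: v).
  by rewrite scale0r addr0; apply: smooth_near_differentiable; case: fg.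
rewrite -/v -[X in 'D_v g X](addr0 (tchart c u)) -(scale0r v).
apply: near_eq_is_derive (is_derive_line dg).
by apply: filterS (near_line w fg.2) => t ->; rewrite tchart_line.
Qed.

(** A fibre line is straight in the induced chart, so the functional is the derivative along
    [row_mx 0 (coords c w)] and [tangent_of] returns it. *)
Lemma gamE u (w : tangent (tproj u)) f : smooth_at f u ->
  gam w f = derive1 (fun t : R => f (mkTM (eta u + t *: w))) 0.
Proof.
have [c Cc cu] := atlas_covers HM (tproj u) => sf.
apply: (tangent_ofE HT (a := row_mx 0 (coords c w)) (tchart_atlas Cc) cu _ sf) => f' g fg.
by rewrite derive1E; apply: derive_val; exact: is_derive_tchart_line.
Qed.

Lemma is_derive_gam u (w : tangent (tproj u)) f : smooth_at f u ->
  is_derive (0 : R) 1 (fun t : R => f (mkTM (eta u + t *: w))) (gam w f).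
Proof.
have [c Cc cu] := atlas_covers HM (tproj u) => sf.
have [g fg] := rep_tchart_exists Cc cu sf; have df := is_derive_tchart_line w Cc cu fg.
by rewrite gamE // derive1E (@derive_val _ _ _ _ _ _ _ df).
Qed.

Lemma gam_rep c u (w : tangent (tproj u)) f g :
  atlas M c -> chart_dom c (tproj u) -> is_rep (C := TM M) (tchart c) u f g ->
  gam w f = 'D_(row_mx 0 (coords c w)) g (tchart c u).
Proof.
move=> Cc cu fg; have df := is_derive_tchart_line w Cc cu fg.
rewrite gamE ?derive1E ?(@derive_val _ _ _ _ _ _ _ df) //.
exact: (rep_tchart_smooth_at Cc cu fg).
Qed.

Lemma gam_tproj u (w : tangent (tproj u)) f : smooth_at f (tproj u) ->
  gam w (f \o @tproj R n M) = 0.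
Proof.
move=> sf; rewrite gamE; last exact: smooth_tproj.
exact: (derive1_cst (f (tproj u))).
Qed.

Lemma rho_gam u (w : tangent (tproj u)) : rho (gam w) = 0.
Proof.
have [c Cc cu] := atlas_covers HM (tproj u).
apply: (tangent_ext HM Cc cu) => i; have sc := smooth_coord HM i Cc cu.
by rewrite rhoE // gam_tproj // tangent0E.
Qed.

Lemma gam0 u f : gam (0 : tangent (tproj u)) f = 0.
Proof.
have [sf|nf] := pselect (smooth_at f u); last by rewrite tangent_nonsmooth.
by rewrite gamE //; under eq_fun do rewrite scaler0; rewrite derive1_cst.
Qed.

Lemma derive_vert (g : 'rV[R]_(n + n) -> R) z x : differentiable g z ->
  'D_(row_mx 0 x) g z = \sum_i x 0 i * 'D_('e_(rshift n i)) g z.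
Proof.
move=> dg; rewrite derive_row_sum // big_split_ord /= big1 ?add0r => [|i _].
  by apply: eq_bigr => i _; rewrite row_mxEr.
by rewrite row_mxEl mxE mul0r.
Qed.

Lemma gamZ u a (w : tangent (tproj u)) f : smooth_at f u ->
  gam (a *: w) f = a * gam w f.
Proof.
have [c Cc cu] := atlas_covers HM (tproj u) => /(rep_tchart_exists Cc cu) [g fg].
have dg : differentiable g (tchart c u) by apply: smooth_near_differentiable; case: fg.
rewrite !(gam_rep _ Cc cu fg) !derive_vert // mulr_sumr.
by apply: eq_bigr => i _; rewrite !mxE tangentZE mulrA.
Qed.

Lemma smooth_pifield_coords c u (W : pifield M) : atlas M c -> chart_dom c (tproj u) ->
  (\forall q \near u, forall i, smooth_at (fun w => W w (fun p => c p 0 i)) q) ->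
  smooth_pifield_at W u.
Proof.
move=> Cc cu sW; have nc := near_tproj HM (near_dom HM Cc cu).
apply: filterS2 nc sW => q cq sWq f /(rep_exists Cc cq) [g fg].
have nc' := near_tproj HM (near_dom HM Cc cq).
have ng := near_tproj HM (near_rep HM Cc cq fg).
apply: (smooth_at_eq (f := fun w => \sum_i W w (fun p => c p 0 i) * 'D_('e_i) g (c (tproj w)))).
  by apply: filterS2 nc' ng => w cw fgw; rewrite (tangentE_sum HM _ Cc cw fgw).
apply: (smooth_sum HT) => i; apply: (smoothM HT) => //.
apply: (smooth_tproj (f := fun p => 'D_('e_i) g (c p))).
apply: (smooth_at_chart_comp HM Cc cq (g := 'D_('e_i) g)).
by apply: smooth_near_derive; case: fg.
Qed.

(** Its components in [c] are constant, so vertical derivatives annihilate it; any vector at a point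
    of the chart extends to such a field. *)
Definition constant_pifield c x : pifield M := fun u => coordvec c (tproj u) x.

Lemma smooth_constant_pifield c x u :
  atlas M c -> chart_dom c (tproj u) -> smooth_pifield_at (constant_pifield c x) u.
Proof.
move=> Cc cu; apply: (smooth_pifield_coords Cc cu).
apply: filterS (near_tproj HM (near_dom HM Cc cu)) => q cq i.
apply: (smooth_at_eq (f := fun=> x 0 i)); last exact: smooth_cst.
apply: filterS (near_tproj HM (near_dom HM Cc cq)) => w cw.
by rewrite /constant_pifield (coordvec_coord HM).
Qed.

Lemma smooth_pifield_apply u (W : pifield M) f : smooth_pifield_at W u ->
  smooth_at f (tproj u) -> smooth_at (fun w => W w f) u.
Proof. by move=> /nbhs_singleton; apply. Qed.

Lemma smooth_pifield_near u (W : pifield M) : smooth_pifield_at W u ->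
  \forall q \near u, smooth_pifield_at W q.
Proof. exact: near_join. Qed.

Lemma smooth_gamF u (W : pifield M) : smooth_pifield_at W u -> smooth_field_at (gamF W) u.
Proof.
move=> /smooth_pifield_near; apply: filterS => q sWq f.
have [c Cc cq] := atlas_covers HM (tproj q).
have cq' : chart_dom (tchart c) q := cq; have Ct := tchart_atlas Cc.
move=> /(rep_exists Ct cq') [g fg].
apply: (smooth_at_eq (f := fun w => \sum_i W w (fun p => c p 0 i)
    * 'D_('e_(rshift n i)) g (tchart c w))).
  apply: filterS2 (near_dom HT Ct cq') (near_rep HT Ct cq' fg) => w cw fgw.
  rewrite /gamF (gam_rep _ Cc cw fgw) derive_vert.
    by apply: eq_bigr => i _; rewrite mxE.
  by apply: smooth_near_differentiable; case: fgw.
apply: (smooth_sum HT) => i; apply: (smoothM HT).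
  by apply: smooth_pifield_apply => //; exact: smooth_coord.
apply: (smooth_at_chart_comp HT Ct cq' (g := 'D_('e_(rshift n i)) g)).
by apply: smooth_near_derive; case: fg.
Qed.

(** In the induced chart this is the derivative in the fixed direction [row_mx 0 x]; it can
    therefore be iterated and the iterates commute. *)
Definition vderive c x (f : TM M -> R) : TM M -> R := fun u => gam (constant_pifield c x u) f.

Lemma coords_constant_pifield c x u :
  atlas M c -> chart_dom c (tproj u) -> coords c (constant_pifield c x u) = x.
Proof. by move=> Cc cu; apply/rowP => i; rewrite mxE (coordvec_coord HM). Qed.

Lemma rep_vderive c x f g u : atlas M c -> chart_dom c (tproj u) ->
  is_rep (C := TM M) (tchart c) u f g ->
  is_rep (C := TM M) (tchart c) u (vderive c x f) ('D_(row_mx 0 x) g).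
Proof.
move=> Cc cu fg; split; first by apply: smooth_near_derive; case: fg.
have cu' : chart_dom (tchart c) u := cu; have Ct := tchart_atlas Cc.
apply: filterS2 (near_dom HT Ct cu') (near_rep HT Ct cu' fg) => w cw fgw.
by rewrite /vderive (gam_rep _ Cc cw fgw) coords_constant_pifield.
Qed.

Lemma smooth_vderive c x f u : atlas M c -> chart_dom c (tproj u) ->
  smooth_at f u -> smooth_at (vderive c x f) u.
Proof.
move=> Cc cu /(rep_tchart_exists Cc cu) [g fg].
exact: (rep_tchart_smooth_at Cc cu (rep_vderive x Cc cu fg)).
Qed.

Lemma vderive_comm c x y f u : atlas M c -> chart_dom c (tproj u) -> smooth_at f u ->
  vderive c x (vderive c y f) u = vderive c y (vderive c x f) u.
Proof.
move=> Cc cu /(rep_tchart_exists Cc cu) [g fg].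
have E a b : vderive c a (vderive c b f) u = 'D_(row_mx 0 a) ('D_(row_mx 0 b) g) (tchart c u).
  by have [_ /nbhs_singleton] := rep_vderive a Cc cu (rep_vderive b Cc cu fg).
by rewrite !E; apply: derive_comm; case: fg.
Qed.

(** Evaluate the bracket on [f \o tproj]: the vertical field [X] kills this function, so one term
    vanishes, and [Y] acts on it as [Z] acts on [f]. *)
Lemma rho_bracket_vertical (X Y : field M) (Z : pifield M) u f :
  smooth_field_at X u -> smooth_field_at Y u ->
  (forall q, rho (X q) = 0) -> (\forall q \near u, rho (Y q) = Z q) ->
  smooth_at f (tproj u) ->
  rho (lie_bracket X Y u) f = X u (fun q => Z q f).
Proof.
move=> sX sY X0 YZ sf; have sft := smooth_tproj sf.
rewrite rhoE // (lie_bracketE HT) //.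
have nf := near_tproj HM (smooth_at_near HM sf).
rewrite [X in _ - X](tangent_eq HT _ (f' := fun=> 0)).
  rewrite (tangent_cst HT) subr0; apply: (tangent_eq HT).
  by apply: filterS2 nf YZ => q sfq <-; rewrite rhoE.
by apply: filterS nf => q sfq; rewrite -rhoE // X0 tangent0E.
Qed.

Lemma lie_bracketN (X Y : field M) u f :
  smooth_field_at X u -> smooth_field_at Y u -> smooth_at f u ->
  lie_bracket Y X u f = - lie_bracket X Y u f.
Proof. by move=> sX sY sf; rewrite !(lie_bracketE HT) // opprB. Qed.

End VerticalCalculus.

(** * The metric as a vertical Hessian *)

Section FinslerCalculus.
Context {R : realType} {n : nat} {M : charted R n}.
Hypothesis HM : smooth_atlas (C := M).
Let HT : smooth_atlas (C := TM M) := TM_atlas HM.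
Implicit Types (c d : chart R n M) (u w : TM M) (x y : 'rV[R]_n).

Lemma smooth_field_eq u (X Y : field M) : (\forall q \near u, X q = Y q) ->
  smooth_field_at X u -> smooth_field_at Y u.
Proof.
move=> XY sX; have XY' : \forall q \near u, \forall w \near q, X w = Y w by exact: near_join.
apply: filterS2 XY' sX => q XYq sXq f /sXq.
by apply: smooth_at_eq; apply: filterS XYq => w ->.
Qed.

Lemma smooth_basic c x u f : atlas M c -> chart_dom c (tproj u) -> smooth_at f (tproj u) ->
  smooth_at (fun p => coordvec c p x f) (tproj u).
Proof.
move=> Cc cu /(rep_exists Cc cu) [g fg].
apply: (smooth_at_eq (f := fun p => 'D_x g (c p))).
  apply: filterS2 (near_dom HM Cc cu) (near_rep HM Cc cu fg) => p cp fgp.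
  by rewrite (coordvecE HM _ Cc cp fgp).
apply: (smooth_at_chart_comp HM Cc cu (g := 'D_x g)).
by apply: smooth_near_derive; case: fg.
Qed.

Lemma gam_constant_pifield c x u (w : tangent (tproj u)) f : atlas M c -> chart_dom c (tproj u) ->
  smooth_at f (tproj u) -> gam w (fun q => constant_pifield c x q f) = 0.
Proof. by move=> Cc cu sf; exact: (gam_tproj HM w (smooth_basic x Cc cu sf)). Qed.

Lemma tangent_energy (F : TM M -> R) u (X : tangent u) : smooth_at F u ->
  X (energy F) = F u * X F.
Proof.
move=> sF; rewrite (_ : energy F = fun q => 2^-1 * (F q * F q)) //.
rewrite (tangentM HT) //; [|exact: smooth_cst|exact: smoothM].
by rewrite (tangent_cst HT) mulr0 addr0 (tangentM HT) //; field.
Qed.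

Lemma smooth_energy (F : TM M -> R) u : smooth_at F u -> smooth_at (energy F) u.
Proof.
move=> sF; rewrite (_ : energy F = fun q => 2^-1 * (F q * F q)) //.
by apply: (smoothM HT); [exact: smooth_cst|exact: smoothM].
Qed.

Section Metric.
Variables (U : set (TM M)) (F : TM M -> R) (O : finsler_objects U F).
Local Notation g u w z := (@metric R n M U F O u w z).
Let E := energy F.

(** Only [rho (hlift O w) = w] enters, so the value is the same for every horizontal map. *)
Lemma rho_vertical_bracket u (W Z : pifield M) f : (\forall q \near u, U q) ->
  smooth_pifield_at W u -> smooth_pifield_at Z u -> smooth_at f (tproj u) ->
  rho (lie_bracket (gamF W) (hmapF (hlift O) Z) u) f = gam (W u) (fun q => Z q f).
Proof.
move=> nU sW sZ sf; have Uu := nbhs_singleton nU.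
apply: (rho_bracket_vertical HM) => //; first exact: smooth_gamF.
- exact: (hmap_smooth (hliftP O)).
- by move=> q; exact: rho_gam.
- by apply: filterS nU => q Uq; exact: (hmap_rho (hliftP O)).
Qed.

(* In [ddJ E (J W, Z) = J W (dJ E Z) - Z (dJ E (J W)) - dJ E [J W, Z]] the second
   term vanishes as [J \o J = 0], the third one as [Z] is constant along [W u]. *)
Lemma metric_vertical u (W Z : pifield M) : (\forall q \near u, U q) ->
  smooth_pifield_at W u -> smooth_pifield_at Z u ->
  (forall f, smooth_at f (tproj u) -> gam (W u) (fun q => Z q f) = 0) ->
  g u (W u) (Z u) = gam (W u) (fun q => gam (Z q) E).
Proof.
move=> nU sW sZ WZ; have Uu := nbhs_singleton nU.
have hr q (w : tangent (tproj q)) : U q -> rho (hlift O w) = w.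
  by move=> Uq; exact: (hmap_rho (hliftP O) Uq).
(* [metricE] evaluates the metric on images under [rho], so both fields are first lifted
   horizontally. *)
pose Wb := hmapF (hlift O) W; pose Zb := hmapF (hlift O) Z.
have sWb : smooth_field_at Wb u by exact: (hmap_smooth (hliftP O)).
have sZb : smooth_field_at Zb u by exact: (hmap_smooth (hliftP O)).
have XE : \forall q \near u, gamF W q = vendF Wb q.
  by apply: filterS nU => q Uq; rewrite /vendF /vend /Wb /hmapF hr.
have sX : smooth_field_at (vendF Wb) u by apply: smooth_field_eq XE _; exact: smooth_gamF.
have nZ : \forall q \near u, rho (Zb q) = Z q.
  by apply: filterS nU => q Uq; exact: hr.
have Xu : vendF Wb u = gam (W u) by rewrite -(nbhs_singleton XE).
have br0 : rho (lie_bracket (vendF Wb) Zb u) = 0.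
  have [c Cc cu] := atlas_covers HM (tproj u).
  apply: (tangent_ext HM Cc cu) => i; have sc := smooth_coord HM i Cc cu.
  rewrite (rho_bracket_vertical HM (Z := Z)) ?tangent0E ?Xu ?WZ //.
  by move=> q; exact: rho_gam.
have -> : g u (W u) (Z u) = g u (rho (Wb u)) (rho (Zb u)) by rewrite !hr.
rewrite (metricE (metricP O) Uu sWb sZb) /ddJ /dform /dJ /extd /vend br0 (gam0 HM) subr0.
rewrite [X in _ - X](tangent_eq HT _ (f' := fun=> 0)); last first.
  by near=> q; rewrite (rho_gam HM) (gam0 HM).
rewrite (tangent_cst HT) subr0 Xu; apply: (tangent_eq HT).
by apply: filterS nZ => q ->.
Unshelve. all: by end_near. Qed.

Lemma metric_vderive c x y u : atlas M c -> chart_dom c (tproj u) ->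
  (\forall q \near u, U q) ->
  g u (constant_pifield c x u) (constant_pifield c y u) = vderive c x (vderive c y E) u.
Proof.
move=> Cc cu nU; apply: (metric_vertical nU).
- exact: smooth_constant_pifield.
- exact: smooth_constant_pifield.
- by move=> f; exact: gam_constant_pifield.
Qed.

(** Extending both vectors by constant fields makes the metric a Hessian, which is symmetric. *)
Lemma metricC u (w z : tangent (tproj u)) : (\forall q \near u, U q) -> smooth_at F u ->
  g u w z = g u z w.
Proof.
have [c Cc cu] := atlas_covers HM (tproj u) => nU sF.
have KE (v : tangent (tproj u)) : constant_pifield c (coords c v) u = v.
  exact: coordvecK.
have E1 := metric_vderive (coords c w) (coords c z) Cc cu nU.
have E2 := metric_vderive (coords c z) (coords c w) Cc cu nU.
rewrite !KE in E1 E2; rewrite E1 E2.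
by apply: (vderive_comm HM) => //; exact: smooth_energy.
Qed.

(** * Consequences of homogeneity *)

Hypotheses (sF : forall q, U q -> smooth_at F q)
  (sU : forall a q, 0 < a -> U q -> U (scaleTM a q))
  (hF : forall a q, 0 < a -> U q -> F (scaleTM a q) = a * F q).

(** The energy is homogeneous of degree 2, so its derivative at [a u] along [a w] is [a ^+ 2] times
    that at [u] along [w]; linearity in the direction removes one factor [a]. *)
Lemma vderive_energy_homogeneous c x u (a : R) : atlas M c -> chart_dom c (tproj u) ->
  (\forall q \near u, U q) -> 0 < a -> vderive c x E (scaleTM a u) = a * vderive c x E u.
Proof.
move=> Cc cu nU a0; have Uu := nbhs_singleton nU.
pose w : tangent (tproj u) := constant_pifield c x u.
have sE q : U q -> smooth_at E q by move=> /sF; exact: smooth_energy.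
have d1 := is_derive_gam HM w (sE _ Uu).
have d2 := is_derive_gam HM (u := scaleTM a u) (a *: w) (sE _ (sU a0 Uu)).
have {}d1 : is_derive (0 : R) 1 (fun t : R => E (mkTM (eta (scaleTM a u) + t *: (a *: w))))
    (a ^+ 2 *: gam w E).
  apply: near_eq_is_derive (is_deriveZ (a ^+ 2) d1).
  apply: filterS (near_line HM w nU) => t Ut; rewrite -[LHS]/(a ^+ 2 * E (mkTM (eta u + t *: w))).
  have -> : mkTM (eta (scaleTM a u) + t *: (a *: w)) = scaleTM a (mkTM (eta u + t *: w)).
    by rewrite /scaleTM /=; congr mkTM; rewrite scalerDr !scalerA (mulrC t).
  by rewrite /E /energy hF //; ring.
have E2 : gam (u := scaleTM a u) (a *: w) E = a ^+ 2 * gam w E.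
  by rewrite -(@derive_val _ _ _ _ _ _ _ d2) (@derive_val _ _ _ _ _ _ _ d1).
have E1 : gam (u := scaleTM a u) (a *: w) E = a * vderive c x E (scaleTM a u).
  exact: (gamZ HM (u := scaleTM a u) a w (sE _ (sU a0 Uu))).
by apply: (mulfI (lt0r_neq0 a0)); rewrite -E1 E2 expr2 mulrA.
Qed.

(** Euler's relation: [g(eta, x)] is the derivative of [vderive c x E] along [eta], and this
    function is homogeneous of degree 1. *)
Lemma metric_eta c x u : atlas M c -> chart_dom c (tproj u) ->
  (\forall q \near u, U q) -> g u (eta u) (constant_pifield c x u) = vderive c x E u.
Proof.
move=> Cc cu nU; have Uu := nbhs_singleton nU.
have sE : smooth_at E u by apply: smooth_energy; exact: sF.
have sV := smooth_vderive HM x Cc cu sE.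
have -> : g u (eta u) (constant_pifield c x u) = gam (eta u) (vderive c x E).
  rewrite -{1}(coordvecK HM (eta u) Cc cu) (metric_vderive _ _ Cc cu nU).
  by rewrite /vderive /constant_pifield (coordvecK HM).
have d1 := is_derive_gam HM (eta u) sV.
rewrite -(@derive_val _ _ _ _ _ _ _ d1).
(* Along the radial line [u + t u = (1 + t) u], and homogeneity applies as soon as [-1 < t]. *)
rewrite (near_eq_derive (g := fun t : R => (1 + t) * vderive c x E u)).
  have dl : is_derive (0 : R) 1 (fun t : R => 1 + t) 1.
    have := is_deriveD (is_derive_cst (1 : R) (0 : R) 1) (is_derive_id (0 : R) 1).
    by rewrite add0r.
  rewrite -[fun t => _]/((fun t : R => 1 + t) * cst (vderive c x E u)).
  by rewrite (@derive_val _ _ _ _ _ _ _ (is_deriveM dl (is_derive_cst (vderive c x E u) _ _)))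
    scaler0 add0r /cst /GRing.scale /= mulr1.
have n1 : \forall t \near (0 : R), -1 < t by apply: lt_nbhsr; rewrite oppr_lt0.
apply: filterS n1 => t t1.
rewrite -(@vderive_energy_homogeneous c x u (1 + t)) //; last by rewrite -subr_gt0; lra.
by congr (vderive c x E _); rewrite /scaleTM scalerDl scale1r.
Qed.

Lemma metric_eta_gam u (w : tangent (tproj u)) : (\forall q \near u, U q) ->
  g u (eta u) w = gam w E.
Proof.
have [c Cc cu] := atlas_covers HM (tproj u) => nU.
by rewrite -(coordvecK HM w Cc cu) (metric_eta _ Cc cu nU).
Qed.

Lemma supportingE u (w : tangent (tproj u)) : (\forall q \near u, U q) ->
  F u != 0 -> supporting F (metric O) w = gam w F.
Proof.
move=> nU F0; rewrite /supporting metric_eta_gam // tangent_energy ?mulKf //.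
exact: sF (nbhs_singleton nU).
Qed.

End Metric.

End FinslerCalculus.

(** * Concurrent fields *)

Section Concurrent.
Context {R : realType} {n : nat} {M : charted R n}.
Hypothesis HM : smooth_atlas (C := M).
Let HT : smooth_atlas (C := TM M) := TM_atlas HM.
Implicit Types (c : chart R n M) (u q : TM M) (x y : 'rV[R]_n).

(** The right-hand side does not mention [F] or [O]: this is the reason why the vertical Berwald
    derivatives for [F] and [Fh] agree. *)
Lemma berwald_vertical (U : set (TM M)) (F : TM M -> R) (O : finsler_objects U F)
    (W Z : pifield M) u f : (\forall q \near u, U q) ->
  smooth_pifield_at W u -> smooth_pifield_at Z u -> smooth_at f (tproj u) ->
  berwald O (gamF W) Z u f = gam (W u) (fun q => Z q f).
Proof.
move=> nU sW sZ sf.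
by rewrite (berwald_v (berwaldP O) (nbhs_singleton nU) sW sZ) (rho_vertical_bracket HM).
Qed.

Variables (F : TM M -> R) (HF : finsler F) (O : finsler_objects (slit M) F).
Variables (phibar : pifield M) (Hphi : concurrent O phibar).
Local Notation g u w z := (@metric R n M (slit M) F O u w z).
Local Notation Phi := (fun u : TM M => g u (phibar u) (eta u)).

Lemma concurrent_fibre_constant u (W : pifield M) f : (\forall q \near u, slit M q) ->
  smooth_pifield_at W u -> smooth_at f (tproj u) -> gam (W u) (fun q => phibar q f) = 0.
Proof.
move=> nU sW sf; have Su := nbhs_singleton nU.
have sphi := concurrent_smooth Hphi Su.
by rewrite -(berwald_vertical O nU) // (concurrent_v Hphi Su sW).2 tangent0E.
Qed.

Lemma slit_scale a u : 0 < a -> slit M u -> slit M (scaleTM a u).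
Proof. by move=> a0 u0; rewrite /slit /= scaler_eq0 negb_or gt_eqF. Qed.

Lemma Phi_gam u : (\forall q \near u, slit M q) -> Phi u = gam (phibar u) (energy F).
Proof.
move=> nU; have sF := finsler_smooth HF.
rewrite (metricC HM) //; last exact: sF (nbhs_singleton nU).
apply: (metric_eta_gam HM) => //; first exact: slit_scale.
by move=> a q a0 _; exact: finsler_homogeneous.
Qed.

Lemma near_Phi_gam u : (\forall q \near u, slit M q) ->
  \forall q \near u, Phi q = gam (phibar q) (energy F).
Proof.
move=> nU; have nnU : \forall q \near u, \forall q' \near q, slit M q' by exact: near_join.
by apply: filterS nnU => q; exact: Phi_gam.
Qed.

(** Smoothness of the metric is not stated in [is_metric]; here it is bypassed by writing [Phi] near
    [u] as the derivative of the energy along the smooth field [gamF phibar]. *)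
Lemma smooth_Phi u : (\forall q \near u, slit M q) -> smooth_at Phi u.
Proof.
move=> nU; have Su := nbhs_singleton nU.
apply: (smooth_at_eq (f := fun q => gamF phibar q (energy F))).
  by apply: filterS (near_Phi_gam nU) => q ->.
apply: smooth_field_apply; first by apply: (smooth_gamF HM); exact: concurrent_smooth Hphi _ Su.
by apply: (smooth_energy HM); exact: finsler_smooth.
Qed.

(** [metric_vertical] applies with second field [phibar], because [phibar] is constant along the
    fibres. *)
Lemma vderive_Phi c x u : atlas M c -> chart_dom c (tproj u) -> (\forall q \near u, slit M q) ->
  vderive c x Phi u = g u (phibar u) (constant_pifield c x u).
Proof.
move=> Cc cu nU; have Su := nbhs_singleton nU; have sF := finsler_smooth HF Su.
have sK := smooth_constant_pifield HM x Cc cu.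
rewrite (metricC HM _ _ _ nU sF) (metric_vertical HM O nU) //.
- by apply: (tangent_eq HT); exact: near_Phi_gam.
- exact: concurrent_smooth Hphi _ Su.
- by move=> f; exact: concurrent_fibre_constant.
Qed.

(** The left-hand side is the first term of the vertical Cartan formula for [phibar] and a constant
    field. The bracket terms vanish since both fields are constant along the fibres, and the
    covariant derivative vanishes by concurrence. *)
Lemma vderive_vderive_Phi c x y u : atlas M c -> chart_dom c (tproj u) ->
  (\forall q \near u, slit M q) -> vderive c x (vderive c y Phi) u = 0.
Proof.
move=> Cc cu nU; have Su := nbhs_singleton nU.
have nnU : \forall q \near u, \forall q' \near q, slit M q' by exact: near_join.
have ndc := near_tproj HM (near_dom HM Cc cu).
have sK z := smooth_constant_pifield HM z Cc cu.
have sphi := concurrent_smooth Hphi Su.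
have E1 : vderive c x (vderive c y Phi) u =
    extd (gfun (metric O) phibar (constant_pifield c y)) (gamF (constant_pifield c x) u).
  by apply: (tangent_eq HT); apply: filterS2 nnU ndc => q nq cq; exact: vderive_Phi.
have rho0 (Z : pifield M) (sZ : smooth_pifield_at Z u) :
    (forall f, smooth_at f (tproj u) -> gam (constant_pifield c x u) (fun q => Z q f) = 0) ->
    rho (lie_bracket (gamF (constant_pifield c x)) (hmapF (hlift O) Z) u) = 0.
  move=> Z0; apply: (tangent_ext HM Cc cu) => i; have sc := smooth_coord HM i Cc cu.
  by rewrite (rho_vertical_bracket HM) // Z0 // tangent0E.
(* This bracket occurs in the opposite order in the Cartan formula; antisymmetry reduces it to
   [rho0]. *)
have rho1 :
    rho (lie_bracket (hmapF (hlift O) (constant_pifield c y)) (gamF (constant_pifield c x)) u) = 0.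
  apply: (tangent_ext HM Cc cu) => i; have sc := smooth_coord HM i Cc cu.
  rewrite (rhoE HM) // (lie_bracketN HM); last first.
  - exact: smooth_tproj.
  - exact: (hmap_smooth (hliftP O)).
  - exact: (smooth_gamF HM).
  rewrite -(rhoE HM) // rho0 ?tangent0E ?oppr0 // => f; exact: gam_constant_pifield.
have rho2 : rho (lie_bracket (gamF (constant_pifield c x)) (hmapF (hlift O) phibar) u) = 0.
  by apply: rho0 => // f; exact: concurrent_fibre_constant.
have g0l z : g u 0 z = 0.
  by have := metric_linearl (metricP O) Su z (-1) 0 0; rewrite /= scaler0 addr0 mulN1r addNr.
have g0r z : g u z 0 = 0.
  by have := metric_linearr (metricP O) Su z (-1) 0 0; rewrite scaler0 addr0 mulN1r addNr.
have := cartan_v (cartanP O) Su (sK x) sphi (sK y).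
by rewrite (concurrent_v Hphi Su (sK x)).1 rho1 rho2 g0l !g0r mulr0 !addr0 E1 => <-.
Qed.

Lemma phi_gam u (w : tangent (tproj u)) : (\forall q \near u, slit M q) ->
  g u (phibar u) w = gam w Phi.
Proof.
have [c Cc cu] := atlas_covers HM (tproj u) => nU.
rewrite -{1}(coordvecK HM w Cc cu) -(vderive_Phi _ Cc cu nU).
by rewrite /vderive /constant_pifield coordvecK.
Qed.

End Concurrent.

(** * First and second derivatives of the relation defining the new structure *)

Section Quotient.
Context {R : realType} {n : nat} {M : charted R n}.
Hypothesis HM : smooth_atlas (C := M).
Let HT : smooth_atlas (C := TM M) := TM_atlas HM.
Variables (F P Q : TM M -> R) (u : TM M).
Hypotheses (sF : smooth_at F u) (sP : smooth_at P u) (sQ : smooth_at Q u).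
Hypothesis QE : \forall q \near u, Q q * F q = F q * F q + Q q * P q.

(** The relation is kept in the polynomial form [Q F = F^2 + Q P], so that the product rule suffices
    and no inverse is differentiated. *)
Lemma quotient_tangent (X : tangent u) :
  Q u * X F + F u * X Q = 2 * F u * X F + (Q u * X P + P u * X Q).
Proof.
have := tangent_eq HT X QE.
rewrite (tangentD HT) ?(tangentM HT) //; try by apply: smoothM.
by move=> ->; ring.
Qed.

End Quotient.

Section QuotientSecond.
Context {R : realType} {n : nat} {M : charted R n}.
Hypothesis HM : smooth_atlas (C := M).
Let HT : smooth_atlas (C := TM M) := TM_atlas HM.

Lemma vderive_vderive_energy (F : TM M -> R) c x y u :
  atlas M c -> chart_dom c (tproj u) -> smooth_at F u ->
  vderive c x (vderive c y (energy F)) u =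
    F u * vderive c x (vderive c y F) u + vderive c y F u * vderive c x F u.
Proof.
move=> Cc cu sF; have sF' := smooth_at_near HT sF.
rewrite {1}/vderive (tangent_eq HT _ (f' := fun q => F q * vderive c y F q)).
  by apply: (tangentM HT) => //; exact: smooth_vderive.
by apply: filterS sF' => q sFq; exact: tangent_energy.
Qed.

Lemma quotient_vderive (F P Q : TM M -> R) c x y u :
  atlas M c -> chart_dom c (tproj u) ->
  smooth_at F u -> smooth_at P u -> smooth_at Q u ->
  (\forall q \near u, Q q * F q = F q * F q + Q q * P q) ->
  Q u * vderive c x (vderive c y F) u + vderive c y F u * vderive c x Q u
    + (F u * vderive c x (vderive c y Q) u + vderive c y Q u * vderive c x F u)
  = 2 * (F u * vderive c x (vderive c y F) u + vderive c y F u * vderive c x F u)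
    + (Q u * vderive c x (vderive c y P) u + vderive c y P u * vderive c x Q u
       + (P u * vderive c x (vderive c y Q) u + vderive c y Q u * vderive c x P u)).
Proof.
move=> Cc cu sF sP sQ QE.
(* The first-order relation is needed on a neighbourhood of [u], not only at [u], to be
   differentiated again. *)
have QEy : \forall q \near u, Q q * vderive c y F q + F q * vderive c y Q q =
    2 * (F q * vderive c y F q) + (Q q * vderive c y P q + P q * vderive c y Q q).
  have QE' : \forall q \near u, \forall q' \near q, Q q' * F q' = F q' * F q' + Q q' * P q'.
    exact: near_join.
  have sF' := smooth_at_near HT sF; have sP' := smooth_at_near HT sP.
  have sQ' := smooth_at_near HT sQ.
  apply: filterS2 (filterI sF' sP') (filterI sQ' QE') => q [sFq sPq] [sQq QEq].
  by have := quotient_tangent HM sFq sPq sQq QEq (gam (constant_pifield c y q)); rewrite -mulrA.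
have sV G : smooth_at G u -> smooth_at (vderive c y G) u by exact: smooth_vderive.
have sVF := sV _ sF; have sVP := sV _ sP; have sVQ := sV _ sQ.
have s2 : smooth_at (fun=> 2 : R) u by exact: smooth_cst.
have smM G H : smooth_at G u -> smooth_at H u -> smooth_at (fun q => G q * H q) u.
  exact: smoothM.
have smD G H : smooth_at G u -> smooth_at H u -> smooth_at (fun q => G q + H q) u.
  exact: smoothD.
have dM G H : smooth_at G u -> smooth_at H u ->
    vderive c x (fun q => G q * H q) u = G u * vderive c x H u + H u * vderive c x G u.
  exact: tangentM.
have dD G H : smooth_at G u -> smooth_at H u ->
    vderive c x (fun q => G q + H q) u = vderive c x G u + vderive c x H u.
  exact: tangentD.
have := tangent_eq HT (gam (constant_pifield c x u)) QEy.
rewrite -/(vderive c x _ u) -/(vderive c x _ u).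
rewrite !dD ?dM; auto.
by rewrite [vderive c x (fun=> 2) u](tangent_cst HT) mulr0 addr0.
Qed.

End QuotientSecond.

(** Here [a], [b], [q] stand for [F], [Phi], [Fh], and [f], [p], [q] followed by [w], [z] for their
    vertical derivatives. The last hypothesis is the twice differentiated relation without the
    Hessian of [Phi]; it is solved for [qwz]. *)
Lemma angular_quotient (R : realFieldType) (a b q fw fz pw pz qw qz fwz qwz : R) :
  a - b != 0 -> q = a ^+ 2 / (a - b) ->
  qw = (2 * a * fw + q * (pw - fw)) / (a - b) ->
  qz = (2 * a * fz + q * (pz - fz)) / (a - b) ->
  q * fwz + fz * qw + (a * qwz + qz * fw)
    = 2 * (a * fwz + fz * fw) + (pz * qw + (b * qwz + qz * pw)) ->
  q * qwz + qz * qw - qw * qz =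
    a ^+ 2 * (a - 2 * b) / (a - b) ^+ 3 * (a * fwz + fz * fw - fw * fz)
    + 2 * a ^+ 4 / (a - b) ^+ 4 * (pw * pz)
    + 2 * b ^+ 2 * a ^+ 2 / (a - b) ^+ 4 * (fw * fz)
    - 2 * b * a ^+ 3 / (a - b) ^+ 4 * (pw * fz + pz * fw).
Proof.
move=> ab0 qE qwE qzE key.
have -> : qwz = (2 * (a * fwz + fz * fw) + pz * qw + qz * pw
    - q * fwz - fz * qw - qz * fw) / (a - b).
  by apply: (mulIf ab0); rewrite divfK //; move: key; lra.
by rewrite qwE qzE qE; field.
Qed.

(** * The four relations between the objects of [Fh] and those of [F] *)

Theorem proposition2p5 (R : realType) (n : nat) (M : charted R n)
    (HM : smooth_manifold M)
    (F : TM M -> R) (HF : finsler F) (O : finsler_objects (slit M) F)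
    (phibar : pifield M) (Hphi : concurrent O phibar) :
  let g := metric O in
  let E := energy F in
  let phi := fun (u : TM M) (w : tangent (tproj u)) => g u (phibar u) w in
  let Phi := fun u : TM M => phi u (eta u) in
  let D : set (TM M) := slit M `&` [set u | Phi u < F u] in
  let Fh := fun u : TM M => F u ^+ 2 / (F u - Phi u) in
  forall (HFh : conic_pseudo_finsler D Fh) (Oh : finsler_objects D Fh),
  let gh := metric Oh in
  let Eh := energy Fh in
  [/\ (* (1) *)
      forall u, D u -> forall X : tangent u,
        extd Eh X =
          F u ^+ 2 * (F u - 2 * Phi u) / (F u - Phi u) ^+ 3 * extd E X
          + F u ^+ 4 / (F u - Phi u) ^+ 3 * extd Phi X,
      (* (2) *)
      forall u, D u -> forall w : tangent (tproj u),
        supporting Fh gh w =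
          F u * (F u - 2 * Phi u) / (F u - Phi u) ^+ 2 * supporting F g w
          + F u ^+ 2 / (F u - Phi u) ^+ 2 * phi u w,
      (* (3) *)
      forall W Z : pifield M,
        (forall u, D u -> smooth_pifield_at W u) ->
        (forall u, D u -> smooth_pifield_at Z u) ->
        forall u, D u -> berwald Oh (gamF W) Z u = berwald O (gamF W) Z u
    & (* (4) *)
      forall u, D u -> forall w z : tangent (tproj u),
        angular Fh gh w z =
          F u ^+ 2 * (F u - 2 * Phi u) / (F u - Phi u) ^+ 3 * angular F g w z
          + 2 * F u ^+ 4 / (F u - Phi u) ^+ 4 * (phi u w * phi u z)
          + 2 * Phi u ^+ 2 * F u ^+ 2 / (F u - Phi u) ^+ 4
            * (supporting F g w * supporting F g z)
          - 2 * Phi u * F u ^+ 3 / (F u - Phi u) ^+ 4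
            * (phi u w * supporting F g z + phi u z * supporting F g w)].
Proof.
have HA := smooth_manifold_atlas HM; have HT := TM_atlas HA.
move=> g E phi Phi D Fh HFh Oh gh Eh.
have nD u : D u -> \forall q \near u, D q.
  by move=> Du; apply: open_nbhs_nbhs; split => //; exact: conic_open (cpf_conic HFh).
have nS u : D u -> \forall q \near u, slit M q.
  by move=> /nD; apply: filterS => q [].
have L0 u : D u -> F u - Phi u != 0 by case=> _ /= Du; rewrite subr_eq0 gt_eqF.
have sF u : D u -> smooth_at F u by case=> Su _; exact: finsler_smooth.
have sP u : D u -> smooth_at Phi u by move=> Du; exact: (smooth_Phi HA HF Hphi (nS u Du)).
have sQ u : D u -> smooth_at Fh u by exact: cpf_smooth.
have QE u : D u -> Fh u * F u = F u * F u + Fh u * Phi u.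
  by move=> /L0 Lu; rewrite /Fh; field.
have nQE u : D u -> \forall q \near u, Fh q * F q = F q * F q + Fh q * Phi q.
  by move=> /nD; apply: filterS => q; exact: QE.
(* The first-order relation is linear in [X Fh], with coefficient [F u - Phi u], which is nonzero on
   [D]. *)
have XFh u (X : tangent u) : D u ->
    X Fh = (2 * F u * X F + Fh u * (X Phi - X F)) / (F u - Phi u).
  move=> Du; apply: (mulIf (L0 _ Du)); rewrite divfK ?L0 //.
  by have := quotient_tangent HA (sF _ Du) (sP _ Du) (sQ _ Du) (nQE _ Du) X; lra.
have phiE u (w : tangent (tproj u)) : D u -> phi u w = gam w Phi.
  by move=> /nS; exact: phi_gam.
have suppF u (w : tangent (tproj u)) : D u -> F u != 0 -> supporting F g w = gam w F.
  move=> Du F0; apply: (supportingE HA) (nS _ Du) F0.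
  - exact: finsler_smooth.
  - exact: slit_scale.
  - by move=> a q a0 _; exact: finsler_homogeneous.
have suppFh u (w : tangent (tproj u)) : D u -> Fh u != 0 -> supporting Fh gh w = gam w Fh.
  move=> Du F0; apply: (supportingE HA) (nD _ Du) F0.
  - exact: sQ.
  - exact: conic_scale (cpf_conic HFh).
  - exact: cpf_homogeneous HFh.
have Fh0 u : D u -> F u != 0 -> Fh u != 0.
  by move=> Du F0; rewrite /Fh mulf_neq0 ?invr_eq0 ?L0 // expf_neq0.
split=> [u Du X|u Du w|W Z sW sZ u Du|u Du w z].
(* Since [X E = F u * X F], and likewise for [Fh], inserting [XFh] leaves a rational identity. *)
- rewrite /extd /Eh /E (tangent_energy HA X (sF _ Du)) (tangent_energy HA X (sQ _ Du)) XFh // /Fh.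
  by field; exact: L0.
- have [F0|F0] := eqVneq (F u) 0.
    (* Both sides vanish, the inverse of zero being zero. *)
    by rewrite /supporting /Fh F0 expr0n /= !mul0r invr0 !mul0r addr0.
  rewrite suppF // suppFh ?Fh0 // phiE // XFh // /Fh.
  by field; exact: L0.
- have [c Cc cu] := atlas_covers HA (tproj u).
  apply: (tangent_ext HA Cc cu) => i; have sc := smooth_coord HA i Cc cu.
  (* Both connections give the derivative of the components of [Z] along [gam (W u)]. *)
  rewrite (berwald_vertical HA Oh (nD _ Du) (sW _ Du) (sZ _ Du) sc).
  by rewrite (berwald_vertical HA O (nS _ Du) (sW _ Du) (sZ _ Du) sc).
- have [c Cc cu] := atlas_covers HA (tproj u).
  have KE (v : tangent (tproj u)) : constant_pifield c (coords c v) u = v by exact: coordvecK.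
  (* With [w] and [z] extended by constant fields, both metrics and the differentiated relation are
     expressed through the same vertical derivatives. *)
  have key := quotient_vderive HA (coords c w) (coords c z) Cc cu
    (sF _ Du) (sP _ Du) (sQ _ Du) (nQE _ Du).
  have ghE := metric_vderive HA Oh (coords c w) (coords c z) Cc cu (nD _ Du).
  have gE := metric_vderive HA O (coords c w) (coords c z) Cc cu (nS _ Du).
  rewrite (vderive_vderive_energy HA _ _ Cc cu (sQ _ Du)) in ghE.
  rewrite (vderive_vderive_energy HA _ _ Cc cu (sF _ Du)) in gE.
  have VE (v : tangent (tproj u)) G : vderive c (coords c v) G u = gam v G by rewrite /vderive KE.
  rewrite !KE !VE in ghE gE key.
  (* This is where concurrence enters the second-order relation: the Hessian of [Phi] along the
     fibre drops out. *)
  have PP : gam w (vderive c (coords c z) Phi) = 0.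
    by rewrite -VE; exact:
      (vderive_vderive_Phi HA HF Hphi (coords c w) (coords c z) Cc cu (nS _ Du)).
  rewrite PP mulr0 add0r in key.
  rewrite /angular [X in X - _ = _]ghE [X in _ * (X - _)]gE.
  have Fhw := XFh u (gam w) Du; have Fhz := XFh u (gam z) Du.
  have [F0|F0] := eqVneq (F u) 0.
    (* Here [Fh] and its differential vanish, hence both sides do. *)
    have Q0 : Fh u = 0 by rewrite /Fh F0 expr0n /= mul0r.
    have Fh00 (X : tangent u) : X Fh = 0 by rewrite XFh // Q0 F0 mulr0 !mul0r addr0 mul0r.
    have s0 (v : tangent (tproj u)) : supporting Fh gh v = 0.
      by rewrite /supporting Q0 invr0 mul0r.
    rewrite !Fh00 !s0 Q0 F0 !expr0n /=.
    by rewrite !(mul0r, mulr0, addr0, subr0).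
  rewrite !suppF // !suppFh ?Fh0 // !phiE //.
  exact: (angular_quotient (L0 _ Du) erefl Fhw Fhz key).
Qed.
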